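(* Let $n\ge2$ and let $r=\theta^y$, $s=\theta^z$ be as in the context, with $r\neq s$, $\gcd\left(y^{n-1}-y^{n-2}z+\cdots+(-1)^{n-1}z^{n-1},\ell\right)=1$ and $\gcd(y-z,\ell)=1$. Let $\chi:\mathfrak u_{r,s}(\mathfrak{sl}_n)\to\mathbb K$ be an algebra map; then $\chi(e_i)=\chi(f_i)=0$ and $\chi(\omega_i)=\chi(\omega_i')=\theta^{\chi_i}$ for some $0\le\chi_i<\ell$ ($1\le i<n$). Then, as $\mathfrak u_{r,s}(\mathfrak{sl}_n)$-modules, $$\mathbb K_\chi\simeq H\bullet_{\chi|_H}g_\chi,\qquad g_\chi=\omega_1'^{\,d_1}\cdots\omega_{n-1}'^{\,d_{n-1}},$$ with $$\begin{pmatrix}d_1\\ \vdots\\ d_{n-1}\end{pmatrix}=A^{-1}\begin{pmatrix}\chi_1\\ \vdots\\ \chi_{n-1}\end{pmatrix}\quad\text{in }(\mathbb Z/\ell\mathbb Z)^{n-1}.$$ Here $\mathbb K_\chi$ is the one-dimensional module $\mathbb K$ with $h\cdot1=\chi(h)1$.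
   Context: $\mathbb K$ is an algebraically closed field of characteristic $0$. Let $n\ge2$, let $r,s\in\mathbb K^\times$ be roots of unity with $r\neq s$, let $\ell$ be the least common multiple of the orders of $r$ and $s$, let $\theta$ be a primitive $\ell$th root of unity, and let $y,z$ be nonnegative integers with $r=\theta^y$, $s=\theta^z$. Let $\epsilon_1,\dots,\epsilon_n$ be an orthonormal basis of a Euclidean space with inner product $\langle\,,\rangle$, and $\alpha_j=\epsilon_j-\epsilon_{j+1}$ for $1\le j<n$. $U=U_{r,s}(\mathfrak{sl}_n)$ is the unital associative $\mathbb K$-algebra generated by $e_j,f_j,\omega_j^{\pm1},(\omega_j')^{\pm1}$ ($1\le j<n$) with relations, for all $1\le i,j<n$ (whenever the indices make sense): (R1) the $\omega_i^{\pm1},(\omega_j')^{\pm1}$ all commute and $\omega_i\omega_i^{-1}=\omega_j'(\omega_j')^{-1}=1$; (R2) $\omega_ie_j=r^{\langle\epsilon_i,\alpha_j\rangle}s^{\langle\epsilon_{i+1},\alpha_j\rangle}e_j\omega_i$, $\omega_if_j=r^{-\langle\epsilon_i,\alpha_j\rangle}s^{-\langle\epsilon_{i+1},\alpha_j\rangle}f_j\omega_i$; (R3) $\omega_i'e_j=r^{\langle\epsilon_{i+1},\alpha_j\rangle}s^{\langle\epsilon_i,\alpha_j\rangle}e_j\omega_i'$, $\omega_i'f_j=r^{-\langle\epsilon_{i+1},\alpha_j\rangle}s^{-\langle\epsilon_i,\alpha_j\rangle}f_j\omega_i'$; (R4) $[e_i,f_j]=\frac{\delta_{i,j}}{r-s}(\omega_i-\omega_i')$;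 (R5) $[e_i,e_j]=[f_i,f_j]=0$ if $|i-j|>1$; (R6) $e_i^2e_{i+1}-(r+s)e_ie_{i+1}e_i+rs\,e_{i+1}e_i^2=0$, $e_ie_{i+1}^2-(r+s)e_{i+1}e_ie_{i+1}+rs\,e_{i+1}^2e_i=0$; (R7) $f_i^2f_{i+1}-(r^{-1}+s^{-1})f_if_{i+1}f_i+r^{-1}s^{-1}f_{i+1}f_i^2=0$, $f_if_{i+1}^2-(r^{-1}+s^{-1})f_{i+1}f_if_{i+1}+r^{-1}s^{-1}f_{i+1}^2f_i=0$. It is a Hopf algebra with $\omega_i,\omega_i'$ group-like, $\Delta(e_i)=e_i\otimes1+\omega_i\otimes e_i$, $\Delta(f_i)=1\otimes f_i+f_i\otimes\omega_i'$, $\epsilon(e_i)=\epsilon(f_i)=0$. Put $\mathcal E_{j,j}=e_j$, $\mathcal E_{i,j}=e_i\mathcal E_{i-1,j}-r^{-1}\mathcal E_{i-1,j}e_i$, $\mathcal F_{j,j}=f_j$, $\mathcal F_{i,j}=f_i\mathcal F_{i-1,j}-s\mathcal F_{i-1,j}f_i$ ($i>j$). The restricted two-parameter quantum group $\mathfrak u_{r,s}(\mathfrak{sl}_n)$ is the (finite-dimensional) Hopf algebra quotient of $U$ by the ideal generated by all $\mathcal E_{i,j}^\ell,\mathcal F_{i,j}^\ell,\omega_i^\ell-1,(\omega_i')^\ell-1$ ($1\le j\le i<n$). $A$ is the $(n-1)\times(n-1)$ tridiagonal matrix with $A_{i,i}=y-z$, $A_{i,i+1}=z$, $A_{i+1,i}=-y$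 and all other entries $0$; $\det A=y^{n-1}-y^{n-2}z+\cdots+(-1)^{n-1}z^{n-1}$, so $A$ is invertible modulo $\ell$ under the gcd assumption. Modules $H\bullet_\beta g$: let $\mathfrak b'$ be the Hopf subalgebra of $\mathfrak u_{r,s}(\mathfrak{sl}_n)$ generated by the $\omega_i',f_i$, and $H=(\mathfrak b')^{\mathrm{coop}}$ (same algebra, opposite comultiplication), so $G(H)=\langle\omega_1',\dots,\omega_{n-1}'\rangle$; $G(H^* )$ is the set of algebra maps $\beta:H\to\mathbb K$. With Sweedler notation and antipode $S$ taken in $H$, put $h\bullet_\beta b=\sum\beta(h_{(2)})h_{(3)}\,b\,S^{-1}(h_{(1)})$ and $H\bullet_\beta g=\{h\bullet_\beta g:h\in H\}\subset H$ for $g\in G(H)$. This is a $\mathfrak u_{r,s}(\mathfrak{sl}_n)$-module (via $\mathfrak u_{r,s}(\mathfrak{sl}_n)\simeq D(H)^{\mathrm{coop}}$, valid under the gcd assumptions): $\omega_i',f_i$ act by $\bullet_\beta$, while $\omega_i$ and $e_i$ act by $u\cdot m=\sum\langle u,m_{(2)}\rangle m_{(1)}$ (with $\Delta_H(m)=\sum m_{(1)}\otimes m_{(2)}$), where $\langle\omega_i,-\rangle:H\to\mathbb K$ is the algebra map with $\langle\omega_i,\omega_j'\rangle=r^{\langle\epsilon_i,\alpha_j\rangle}s^{\langle\epsilon_{i+1},\alpha_j\rangle}$, $\langle\omega_i,f_j\rangle=0$, and $\langle e_i,-\rangle$ is the linear functional with $\langle e_i,xy\rangle=\langle e_i,x\rangle\epsilon(y)+\langle\omega_i,x\rangle\langle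 e_i,y\rangle$, $\langle e_i,\omega_j'\rangle=0$, $\langle e_i,f_j\rangle=\frac{\delta_{i,j}}{s-r}$. *)

(* Defs.v *)
From HB Require Import structures.
From mathcomp Require Import all_boot all_order all_algebra.
From mathcomp Require Import boolp monalg.

Set Implicit Arguments.
Unset Strict Implicit.
Unset Printing Implicit Defensive.

Import GRing.Theory.

Local Open Scope ring_scope.
Local Open Scope quotient_scope.

(* Quotient of an algebra by a two-sided ideal.  The MathComp structure
   algType excludes the zero ring, so the relations come with an algebra map
   to K that kills them (below this is always the counit). *)

Section QuotientAlgebra.
Variables (K : fieldType) (A : algType K).

Inductive ideal_gen (P : A -> Prop) : A -> Prop :=
| ideal_gen0 : ideal_gen P 0
| ideal_genD a p b x :
    P p -> ideal_gen P x -> ideal_gen P (a * p * b + x).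

Record augmentation (P : A -> Prop) := Augmentation {
  aug :> {lrmorphism A -> K^o};
  augP : forall p, P p -> aug p = 0
}.

Variables (P : A -> Prop) (e : augmentation P).

Lemma ideal_add x y : ideal_gen P x -> ideal_gen P y -> ideal_gen P (x + y).
Proof.
move=> Ix Iy; elim: Ix => [|a p b x' Pp _ IH]; first by rewrite add0r.
by rewrite -addrA; apply: ideal_genD.
Qed.

Lemma ideal_mull c x : ideal_gen P x -> ideal_gen P (c * x).
Proof.
elim=> [|a p b x' Pp _ IH]; first by rewrite mulr0; apply: ideal_gen0.
by rewrite mulrDr !mulrA; apply: ideal_genD.
Qed.

Lemma ideal_mulr c x : ideal_gen P x -> ideal_gen P (x * c).
Proof.
elim=> [|a p b x' Pp _ IH]; first by rewrite mul0r; apply: ideal_gen0.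
by rewrite mulrDl -!mulrA mulrA; apply: ideal_genD.
Qed.

Lemma ideal_opp x : ideal_gen P x -> ideal_gen P (- x).
Proof. by rewrite -mulN1r; apply: ideal_mull. Qed.

Lemma ideal_scale k x : ideal_gen P x -> ideal_gen P (k *: x).
Proof. by rewrite -mulr_algl; apply: ideal_mull. Qed.

Lemma ideal_aug x : ideal_gen P x -> e x = 0.
Proof.
elim=> [|a p b x' Pp _ IH]; first by rewrite rmorph0.
by rewrite rmorphD !rmorphM /= IH (augP e Pp) mulr0 mul0r add0r.
Qed.

Definition ideal_equiv (x y : A) := `[< ideal_gen P (x - y) >].

Lemma ideal_equiv_refl : reflexive ideal_equiv.
Proof. by move=> x; apply/asboolP; rewrite subrr; apply: ideal_gen0. Qed.

Lemma ideal_equiv_sym : symmetric ideal_equiv.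
Proof.
by move=> x y; apply/asboolP/asboolP => /ideal_opp; rewrite opprB.
Qed.

Lemma ideal_equiv_trans : transitive ideal_equiv.
Proof.
move=> y x z /asboolP xy /asboolP yz; apply/asboolP.
by have := ideal_add xy yz; rewrite addrA subrK.
Qed.

Definition ideal_equivR :=
  EquivRel ideal_equiv ideal_equiv_refl ideal_equiv_sym ideal_equiv_trans.

Definition quot_alg of augmentation P : Type := {eq_quot ideal_equivR}.
Local Notation Q := (quot_alg e).

HB.instance Definition _ := Choice.on Q.

Definition quot_pi (x : A) : Q := \pi_{eq_quot ideal_equivR} x.
Definition quot_repr (x : Q) : A := repr (x : {eq_quot ideal_equivR}).

Lemma quot_reprK : cancel quot_repr quot_pi.
Proof. by move=> x; rewrite /quot_pi /quot_repr reprK. Qed.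

Lemma quot_piP x y : quot_pi x = quot_pi y <-> ideal_gen P (x - y).
Proof.
split=> [/eqquotP /asboolP //|I].
by apply/eqquotP; rewrite /=; apply/asboolP.
Qed.

Lemma quot_pi_repr x : ideal_gen P (quot_repr (quot_pi x) - x).
Proof. by apply/quot_piP; rewrite quot_reprK. Qed.

Definition quot_add (x y : Q) := quot_pi (quot_repr x + quot_repr y).
Definition quot_opp (x : Q) := quot_pi (- quot_repr x).
Definition quot_mul (x y : Q) := quot_pi (quot_repr x * quot_repr y).
Definition quot_scale k (x : Q) := quot_pi (k *: quot_repr x).

Lemma quot_addE x y : quot_add (quot_pi x) (quot_pi y) = quot_pi (x + y).
Proof.
apply/quot_piP; have := ideal_add (quot_pi_repr x) (quot_pi_repr y).
by rewrite addrACA opprD.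
Qed.

Lemma quot_oppE x : quot_opp (quot_pi x) = quot_pi (- x).
Proof. by apply/quot_piP; rewrite -opprD; apply/ideal_opp/quot_pi_repr. Qed.

Lemma quot_mulE x y : quot_mul (quot_pi x) (quot_pi y) = quot_pi (x * y).
Proof.
apply/quot_piP; have Ix := quot_pi_repr x; have Iy := quot_pi_repr y.
have := ideal_add (ideal_mulr (quot_repr (quot_pi y)) Ix) (ideal_mull x Iy).
by rewrite mulrBl mulrBr addrA subrK.
Qed.

Lemma quot_scaleE k x : quot_scale k (quot_pi x) = quot_pi (k *: x).
Proof. by apply/quot_piP; rewrite -scalerBr; apply/ideal_scale/quot_pi_repr. Qed.

Lemma quot_ind (T : Q -> Prop) : (forall x, T (quot_pi x)) -> forall x, T x.
Proof. by move=> h x; rewrite -(quot_reprK x). Qed.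

Local Ltac quot_tac lem :=
  do ?[elim/quot_ind => ?]; rewrite ?(quot_addE, quot_oppE, quot_mulE, quot_scaleE) lem.

Fact quot_addA : associative quot_add.
Proof. by quot_tac addrA. Qed.
Fact quot_addC : commutative quot_add.
Proof. by quot_tac addrC. Qed.
Fact quot_add0 : left_id (quot_pi 0) quot_add.
Proof. by quot_tac add0r. Qed.
Fact quot_addN : left_inverse (quot_pi 0) quot_opp quot_add.
Proof. by quot_tac addNr. Qed.

HB.instance Definition _ :=
  GRing.isZmodule.Build Q quot_addA quot_addC quot_add0 quot_addN.

Fact quot_mulA : associative quot_mul.
Proof. by quot_tac mulrA. Qed.
Fact quot_mul1 : left_id (quot_pi 1) quot_mul.
Proof. by quot_tac mul1r. Qed.
Fact quot_mulr1 : right_id (quot_pi 1) quot_mul.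
Proof. by quot_tac mulr1. Qed.
Fact quot_mulDl : left_distributive quot_mul +%R.
Proof.
by do 3!elim/quot_ind => ?; rewrite /GRing.add /= !(quot_addE, quot_mulE) mulrDl.
Qed.
Fact quot_mulDr : right_distributive quot_mul +%R.
Proof.
by do 3!elim/quot_ind => ?; rewrite /GRing.add /= !(quot_addE, quot_mulE) mulrDr.
Qed.
Fact quot_1neq0 : quot_pi 1 != 0.
Proof.
apply/eqP => /quot_piP; rewrite subr0 => /ideal_aug /eqP.
by rewrite rmorph1 oner_eq0.
Qed.

HB.instance Definition _ := GRing.Zmodule_isNzRing.Build Q
  quot_mulA quot_mul1 quot_mulr1 quot_mulDl quot_mulDr quot_1neq0.

Fact quot_scaleA a b (x : Q) :
  quot_scale a (quot_scale b x) = quot_scale (a * b) x.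
Proof. by elim/quot_ind: x => x; rewrite !quot_scaleE scalerA. Qed.
Fact quot_scale1 : left_id 1 quot_scale.
Proof. by quot_tac scale1r. Qed.
Fact quot_scaleDr : right_distributive quot_scale +%R.
Proof.
move=> a; do 2!elim/quot_ind => ?.
by rewrite /GRing.add /= !(quot_addE, quot_scaleE) scalerDr.
Qed.
Fact quot_scaleDl (x : Q) : {morph quot_scale^~ x : a b / a + b}.
Proof.
elim/quot_ind: x => x a b.
by rewrite [RHS]/GRing.add /= !(quot_addE, quot_scaleE) scalerDl.
Qed.

HB.instance Definition _ := GRing.Zmodule_isLmodule.Build K Q
  quot_scaleA quot_scale1 quot_scaleDr quot_scaleDl.

Fact quot_scaleAl (a : K) (x y : Q) : a *: (x * y) = a *: x * y.
Proof.
elim/quot_ind: x => x; elim/quot_ind: y => y.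
by rewrite /GRing.scale /GRing.mul /= !(quot_mulE, quot_scaleE) scalerAl.
Qed.
HB.instance Definition _ := GRing.Lmodule_isLalgebra.Build K Q quot_scaleAl.

Fact quot_scaleAr (a : K) (x y : Q) : a *: (x * y) = x * (a *: y).
Proof.
elim/quot_ind: x => x; elim/quot_ind: y => y.
by rewrite /GRing.scale /GRing.mul /= !(quot_mulE, quot_scaleE) scalerAr.
Qed.
HB.instance Definition _ := GRing.Lalgebra_isAlgebra.Build K Q quot_scaleAr.

Fact quot_pi_zmod : zmod_morphism quot_pi.
Proof.
by move=> x y; rewrite /GRing.add /GRing.opp /= !(quot_addE, quot_oppE).
Qed.
Fact quot_pi_monoid : monoid_morphism quot_pi.
Proof. by split=> // x y; rewrite /GRing.mul /= quot_mulE. Qed.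
Fact quot_pi_scalable : scalable quot_pi.
Proof. by move=> k x; rewrite /GRing.scale /= quot_scaleE. Qed.

HB.instance Definition _ := GRing.isZmodMorphism.Build A Q quot_pi quot_pi_zmod.
HB.instance Definition _ :=
  GRing.isMonoidMorphism.Build A Q quot_pi quot_pi_monoid.
HB.instance Definition _ :=
  GRing.isScalable.Build K A Q *:%R quot_pi quot_pi_scalable.

Definition quot_aug (x : Q) : K^o := e (quot_repr x).

Lemma quot_augE x : quot_aug (quot_pi x) = e x.
Proof. by apply/eqP; rewrite -subr_eq0 -rmorphB; apply/eqP/ideal_aug/quot_pi_repr. Qed.

Fact quot_aug_zmod : zmod_morphism quot_aug.
Proof.
by do 2!elim/quot_ind => ?; rewrite -rmorphB !quot_augE rmorphB.
Qed.
Fact quot_aug_monoid : monoid_morphism quot_aug.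
Proof.
split; first by rewrite -[1](rmorph1 quot_pi) quot_augE rmorph1.
by do 2!elim/quot_ind => ?; rewrite -rmorphM !quot_augE rmorphM.
Qed.
Fact quot_aug_scalable : scalable quot_aug.
Proof.
by move=> k; elim/quot_ind => ?; rewrite -linearZ !quot_augE linearZ.
Qed.

HB.instance Definition _ :=
  GRing.isZmodMorphism.Build Q K^o quot_aug quot_aug_zmod.
HB.instance Definition _ :=
  GRing.isMonoidMorphism.Build Q K^o quot_aug quot_aug_monoid.
HB.instance Definition _ :=
  GRing.isScalable.Build K Q K^o *:%R quot_aug quot_aug_scalable.

End QuotientAlgebra.

(* The tensor product over a field: finite sums of pure tensors, encoded as
   lists of pairs, two lists being identified when every bilinear map takes
   the same value on them. *)

Section Tensor.
Variables (K : fieldType) (V W : lmodType K).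

Definition tsum (M : lmodType K) (f : V -> W -> M) (s : seq (V * W)) : M :=
  \sum_(p <- s) f p.1 p.2.

Definition bilin (M : lmodType K) (f : V -> W -> M) : Prop :=
  (forall w, linear (f^~ w)) /\ (forall v, linear (f v)).

Definition tens_eq (s t : seq (V * W)) : Prop :=
  forall (M : lmodType K) (f : V -> W -> M), bilin f -> tsum f s = tsum f t.

Definition tens_equiv s t := `[< tens_eq s t >].

Lemma tens_equiv_refl : reflexive tens_equiv.
Proof. by move=> s; apply/asboolP. Qed.
Lemma tens_equiv_sym : symmetric tens_equiv.
Proof. by move=> s t; apply/asboolP/asboolP => h M f /h ->. Qed.
Lemma tens_equiv_trans : transitive tens_equiv.
Proof.
move=> t s u /asboolP st /asboolP tu; apply/asboolP => M f fB.
by rewrite st // tu.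
Qed.

Definition tens_equivR :=
  EquivRel tens_equiv tens_equiv_refl tens_equiv_sym tens_equiv_trans.

Definition tensor : Type := {eq_quot tens_equivR}.
HB.instance Definition _ := Choice.on tensor.

Definition tens_pi (s : seq (V * W)) : tensor := \pi_{eq_quot tens_equivR} s.
Definition tens_repr (x : tensor) : seq (V * W) :=
  repr (x : {eq_quot tens_equivR}).

Definition tens (v : V) (w : W) : tensor := tens_pi [:: (v, w)].

(* The linear map induced by a bilinear map f, i.e. the Sweedler-type sum
   \sum f x_(1) x_(2). *)
Definition tlift (M : lmodType K) (f : V -> W -> M) (x : tensor) : M :=
  tsum f (tens_repr x).

Lemma tens_reprK : cancel tens_repr tens_pi.
Proof. by move=> x; rewrite /tens_pi /tens_repr reprK. Qed.

Lemma tens_piP s t : tens_pi s = tens_pi t <-> tens_eq s t.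
Proof.
split=> [/eqquotP /asboolP //|I].
by apply/eqquotP; rewrite /=; apply/asboolP.
Qed.

Lemma tens_ind (T : tensor -> Prop) :
  (forall s, T (tens_pi s)) -> forall x, T x.
Proof. by move=> h x; rewrite -(tens_reprK x). Qed.

Lemma tlift_pi (M : lmodType K) (f : V -> W -> M) s :
  bilin f -> tlift f (tens_pi s) = tsum f s.
Proof. by move=> fB; apply: (proj1 (tens_piP _ _)) fB; rewrite tens_reprK. Qed.

Lemma tsum_cat (M : lmodType K) (f : V -> W -> M) s t :
  tsum f (s ++ t) = tsum f s + tsum f t.
Proof. exact: big_cat. Qed.

Definition tscale_seq (k : K) (s : seq (V * W)) :=
  [seq (k *: p.1, p.2) | p <- s].

Lemma tsum_scale (M : lmodType K) (f : V -> W -> M) k s :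
  bilin f -> tsum f (tscale_seq k s) = k *: tsum f s.
Proof.
move=> [fl _]; rewrite /tsum big_map scaler_sumr; apply: eq_bigr => -[v w] _ /=.
exact: (scalable_linear (fl w)).
Qed.

Definition tens_add (x y : tensor) := tens_pi (tens_repr x ++ tens_repr y).
Definition tens_scale k (x : tensor) := tens_pi (tscale_seq k (tens_repr x)).
Definition tens_opp (x : tensor) := tens_scale (-1) x.

Lemma tens_repr_pi s : tens_eq (tens_repr (tens_pi s)) s.
Proof. by apply/tens_piP; rewrite tens_reprK. Qed.

Lemma tens_addE s t : tens_add (tens_pi s) (tens_pi t) = tens_pi (s ++ t).
Proof.
by apply/tens_piP => M f fB; rewrite !tsum_cat !tens_repr_pi.
Qed.

Lemma tens_scaleE k s : tens_scale k (tens_pi s) = tens_pi (tscale_seq k s).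
Proof.
by apply/tens_piP => M f fB; rewrite !tsum_scale // tens_repr_pi.
Qed.

Fact tens_addA : associative tens_add.
Proof. by do 3!elim/tens_ind => ?; rewrite !tens_addE catA. Qed.
Fact tens_addC : commutative tens_add.
Proof.
do 2!elim/tens_ind => ?; rewrite !tens_addE; apply/tens_piP => M f fB.
by rewrite !tsum_cat addrC.
Qed.
Fact tens_add0 : left_id (tens_pi [::]) tens_add.
Proof. by elim/tens_ind => ?; rewrite !tens_addE. Qed.
Fact tens_addN : left_inverse (tens_pi [::]) tens_opp tens_add.
Proof.
elim/tens_ind => ?; rewrite /tens_opp tens_scaleE tens_addE; apply/tens_piP => M f fB.
by rewrite tsum_cat tsum_scale // scaleN1r addNr /tsum big_nil.
Qed.

HB.instance Definition _ :=
  GRing.isZmodule.Build tensor tens_addA tens_addC tens_add0 tens_addN.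

Fact tens_scaleA a b x : tens_scale a (tens_scale b x) = tens_scale (a * b) x.
Proof.
elim/tens_ind: x => ?; rewrite !tens_scaleE; apply/tens_piP => M f fB.
by rewrite !tsum_scale // scalerA.
Qed.
Fact tens_scale1 : left_id 1 tens_scale.
Proof.
elim/tens_ind => ?; rewrite !tens_scaleE; apply/tens_piP => M f fB.
by rewrite !tsum_scale // scale1r.
Qed.
Fact tens_scaleDr : right_distributive tens_scale +%R.
Proof.
move=> a; do 2!elim/tens_ind => ?.
rewrite /GRing.add /= !(tens_addE, tens_scaleE); apply/tens_piP => M f fB.
by rewrite !(tsum_cat, tsum_scale) // scalerDr.
Qed.
Fact tens_scaleDl x : {morph tens_scale^~ x : a b / a + b}.
Proof.
elim/tens_ind: x => x a b.
rewrite [RHS]/GRing.add /= !(tens_addE, tens_scaleE); apply/tens_piP => M f fB.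
by rewrite !(tsum_cat, tsum_scale) // scalerDl.
Qed.

HB.instance Definition _ := GRing.Zmodule_isLmodule.Build K tensor
  tens_scaleA tens_scale1 tens_scaleDr tens_scaleDl.

Lemma bilin_tens : bilin tens.
Proof.
split=> [w k v v'|v k w w']; rewrite /GRing.scale /GRing.add /= tens_scaleE
  tens_addE; apply/tens_piP => M f [fl fr]; rewrite /tsum !big_cons !big_nil /= !addr0.
- by rewrite (fl w k v v') (scalable_linear (fl w)).
- rewrite (fr v k w w'); congr (_ + _).
  exact/esym/(scalable_linear (fl w)).
Qed.

Lemma tlift_tens (M : lmodType K) (f : V -> W -> M) v w : bilin f -> tlift f (tens v w) = f v w.
Proof. by move=> fB; rewrite tlift_pi // /tsum big_cons big_nil addr0. Qed.

Lemma tlift_linear (M : lmodType K) (f : V -> W -> M) : bilin f -> linear (tlift f).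
Proof.
move=> fB k; do 2!elim/tens_ind => ?.
rewrite {1}/GRing.scale {1}/GRing.add /= tens_scaleE tens_addE !tlift_pi //.
by rewrite tsum_cat tsum_scale.
Qed.

Lemma tens_piE s : tens_pi s = \sum_(p <- s) tens p.1 p.2.
Proof.
elim: s => [|[v w] s IH]; first by rewrite big_nil.
by rewrite big_cons -IH /GRing.add /= tens_addE.
Qed.

End Tensor.

Section TensorRing.
Variables (K : fieldType) (A B : algType K).
Local Notation T := (tensor A B).

Definition tmul_seq (s t : seq (A * B)) : seq (A * B) :=
  [seq (p.1 * q.1, p.2 * q.2) | p <- s, q <- t].

Lemma tsum_mul (M : lmodType K) (f : A -> B -> M) s t :
  tsum f (tmul_seq s t) =
  tsum (fun a b => tsum (fun a' b' => f (a * a') (b * b')) t) s.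
Proof. by rewrite /tsum big_allpairs_dep. Qed.

Lemma tsum_mulC (M : lmodType K) (f : A -> B -> M) s t :
  tsum f (tmul_seq s t) =
  tsum (fun a' b' => tsum (fun a b => f (a * a') (b * b')) s) t.
Proof. by rewrite tsum_mul /tsum exchange_big. Qed.

Lemma bilin_sum (V W M : lmodType K) I (r : seq I) (f : I -> V -> W -> M) :
  (forall i, bilin (f i)) -> bilin (fun v w => \sum_(i <- r) f i v w).
Proof.
move=> fB; split=> [w k v v'|v k w w']; rewrite scaler_sumr -big_split /=;
  by apply: eq_bigr => i _; rewrite ((fB i).1, (fB i).2).
Qed.

Lemma bilin_mull (M : lmodType K) (f : A -> B -> M) a b :
  bilin f -> bilin (fun x y => f (a * x) (b * y)).
Proof.
move=> fB; split=> [y k x x'|x k y y']; rewrite mulrDr -scalerAr.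
- by rewrite fB.1.
- by rewrite fB.2.
Qed.

Lemma bilin_mulr (M : lmodType K) (f : A -> B -> M) a b :
  bilin f -> bilin (fun x y => f (x * a) (y * b)).
Proof.
move=> fB; split=> [y k x x'|x k y y']; rewrite mulrDl -scalerAl.
- by rewrite fB.1.
- by rewrite fB.2.
Qed.

Lemma tmul_eq s s' t t' : tens_eq s s' -> tens_eq t t' ->
  tens_eq (tmul_seq s t) (tmul_seq s' t').
Proof.
move=> ss tt M f fB; transitivity (tsum f (tmul_seq s' t)).
  by rewrite !tsum_mul; apply: ss; apply: bilin_sum => p; apply: bilin_mulr.
by rewrite !tsum_mulC; apply: tt; apply: bilin_sum => p; apply: bilin_mull.
Qed.

Definition tens_mul (x y : T) : T := tens_pi (tmul_seq (tens_repr x) (tens_repr y)).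

Lemma tens_mulE s t :
  tens_mul (tens_pi s) (tens_pi t) = tens_pi (tmul_seq s t).
Proof. by apply/tens_piP/tmul_eq; apply: tens_repr_pi. Qed.

Fact tens_mulA : associative tens_mul.
Proof.
do 3!elim/tens_ind => ?; rewrite !tens_mulE; apply/tens_piP => M f fB.
rewrite !tsum_mul; apply: eq_bigr => p _; rewrite tsum_mul.
by do 2!apply: eq_bigr => ? _; rewrite !mulrA.
Qed.
Fact tens_mul1 : left_id (tens 1 1) tens_mul.
Proof.
elim/tens_ind => s; rewrite tens_mulE; apply/tens_piP => M f fB.
rewrite tsum_mul /tsum big_seq1; by apply: eq_bigr => ? _; rewrite !mul1r.
Qed.
Fact tens_mulr1 : right_id (tens 1 1) tens_mul.
Proof.
elim/tens_ind => s; rewrite tens_mulE; apply/tens_piP => M f fB.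
rewrite tsum_mulC /tsum big_seq1; by apply: eq_bigr => ? _; rewrite !mulr1.
Qed.
Fact tens_mulDl : left_distributive tens_mul +%R.
Proof.
do 3!elim/tens_ind => ?; rewrite /GRing.add /= !(tens_addE, tens_mulE).
by apply/tens_piP => M f fB; rewrite !(tsum_cat, tsum_mul).
Qed.
Fact tens_mulDr : right_distributive tens_mul +%R.
Proof.
do 3!elim/tens_ind => ?; rewrite /GRing.add /= !(tens_addE, tens_mulE).
by apply/tens_piP => M f fB; rewrite !(tsum_cat, tsum_mulC).
Qed.

HB.instance Definition _ := GRing.Zmodule_isPzRing.Build T
  tens_mulA tens_mul1 tens_mulr1 tens_mulDl tens_mulDr.

Lemma tensM a a' b b' : tens a b * tens a' b' = tens (a * a') (b * b') :> T.
Proof. by rewrite /GRing.mul /= tens_mulE. Qed.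

End TensorRing.

Section Hopf.
Variable K : fieldType.

Definition tmap (V W V' W' : lmodType K) (f : V -> V') (g : W -> W')
    (x : tensor V W) : tensor V' W' :=
  tlift (fun v w => tens (f v) (g w)) x.

Definition tswap (V W : lmodType K) (x : tensor V W) : tensor W V :=
  tlift (fun v w => tens w v) x.

Record hopf_structure (A : algType K) := HopfStructure {
  comul : {linear A -> tensor A A};
  counit : {lrmorphism A -> K^o};
  antipode : {linear A -> A};
  comul1 : comul 1 = 1;
  comulM : forall x y, comul (x * y) = comul x * comul y;
  comulA : forall x,
    tlift (fun a b => tlift (fun a1 a2 => tens a1 (tens a2 b)) (comul a))
      (comul x)
    = tlift (fun a b => tens a (comul b)) (comul x);
  comul_counitl : forall x, tlift (fun a b => (counit a : K) *: b) (comul x) = x;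
  comul_counitr : forall x, tlift (fun a b => (counit b : K) *: a) (comul x) = x;
  comul_antipodel : forall x,
    tlift (fun a b => antipode a * b) (comul x) = (counit x : K)%:A;
  comul_antipoder : forall x,
    tlift (fun a b => a * antipode b) (comul x) = (counit x : K)%:A
}.

(* h *_beta b = \sum beta(h_(2)) h_(3) b S^-1(h_(1)), with
   h_(1) (x) h_(2) (x) h_(3) computed as (Delta (x) id) Delta(h); Sinv stands
   for the inverse of the antipode. *)
Definition bullet (A : algType K) (H : hopf_structure A) (Sinv : A -> A)
    (beta : {lrmorphism A -> K^o}) (h b : A) : A :=
  tlift (fun h12 h3 =>
    tlift (fun h1 h2 => (beta h2 : K) *: (h3 * b * Sinv h1)) (comul H h12))
  (comul H h).

(* phi . m = \sum phi(m_(2)) m_(1) *)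
Definition coact (A : algType K) (H : hopf_structure A) (phi : A -> K) (m : A) :
    A :=
  tlift (fun m1 m2 => phi m2 *: m1) (comul H m).

End Hopf.

Section GeneratedSubalgebra.
Variables (K : fieldType) (A : algType K) (X : A -> Prop).

Inductive subalg_gen : A -> Prop :=
| subalg_gen_in x : X x -> subalg_gen x
| subalg_gen1 : subalg_gen 1
| subalg_genD k x y : subalg_gen x -> subalg_gen y -> subalg_gen (k *: x + y)
| subalg_genM x y : subalg_gen x -> subalg_gen y -> subalg_gen (x * y).

Definition subalg_pred : {pred A} := fun x => `[< subalg_gen x >].

Fact subalg_pred_closed : GRing.subsemialg_closed subalg_pred.
Proof.
apply: GRing.subalg_closed_semi; split.
- by apply/asboolP; apply: subalg_gen1.
- by move=> k x y /asboolP hx /asboolP hy; apply/asboolP; apply: subalg_genD.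
- by move=> x y /asboolP hx /asboolP hy; apply/asboolP; apply: subalg_genM.
Qed.
HB.instance Definition _ :=
  GRing.isSubalgClosed.Build K A subalg_pred subalg_pred_closed.

Definition subalg : Type := {x : A | x \in subalg_pred}.
HB.instance Definition _ := SubChoice.on subalg.
HB.instance Definition _ := [SubChoice_isSubAlgebra of subalg by <:].

Lemma subalg_inP x : X x -> x \in subalg_pred.
Proof. by move=> Xx; apply/asboolP; apply: subalg_gen_in. Qed.

Definition gen_subalg : algType K := subalg.
Definition subalg_in x (Xx : X x) : gen_subalg := exist _ x (subalg_inP Xx).

Definition subalg_val (x : gen_subalg) : A := sval x.
Fact subalg_val_zmod : zmod_morphism subalg_val. Proof. by []. Qed.
Fact subalg_val_monoid : monoid_morphism subalg_val. Proof. by []. Qed.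
Fact subalg_val_scalable : scalable subalg_val. Proof. by []. Qed.
HB.instance Definition _ :=
  GRing.isZmodMorphism.Build gen_subalg A subalg_val subalg_val_zmod.
HB.instance Definition _ :=
  GRing.isMonoidMorphism.Build gen_subalg A subalg_val subalg_val_monoid.
HB.instance Definition _ :=
  GRing.isScalable.Build K gen_subalg A *:%R subalg_val subalg_val_scalable.

Definition subalg_res (chi : {lrmorphism A -> K^o}) :
    {lrmorphism gen_subalg -> K^o} :=
  [the {lrmorphism gen_subalg -> K^o} of chi \o subalg_val].

End GeneratedSubalgebra.

Section CharacterModule.
Variables (K : fieldType) (A : algType K) (chi : {lrmorphism A -> K^o}).

Definition char_module of {lrmorphism A -> K^o} : Type := K.
Local Notation M := (char_module chi).

HB.instance Definition _ := GRing.Zmodule.copy M K.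

Definition char_scale (a : A) (c : M) : M := (chi a : K) * (c : K).

Fact char_scaleA a b c : char_scale a (char_scale b c) = char_scale (a * b) c.
Proof. by rewrite /char_scale rmorphM mulrA. Qed.
Fact char_scale1 : left_id 1 char_scale.
Proof. by move=> c; rewrite /char_scale rmorph1 mul1r. Qed.
Fact char_scaleDr : right_distributive char_scale +%R.
Proof. by move=> a c d; rewrite /char_scale mulrDr. Qed.
Fact char_scaleDl c : {morph char_scale^~ c : a b / a + b}.
Proof. by move=> a b; rewrite /char_scale rmorphD mulrDl. Qed.
HB.instance Definition _ := GRing.Zmodule_isLmodule.Build A M
  char_scaleA char_scale1 char_scaleDr char_scaleDl.

End CharacterModule.

Section FreeAlgebra.
Variables (K : fieldType) (I : choiceType).

Definition free_alg : Type := {malg K[{fmonom I}]}.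
HB.instance Definition _ := GRing.Lalgebra.on free_alg.

Fact free_scaleAr (a : K) (x y : free_alg) : a *: (x * y) = x * (a *: y).
Proof.
rewrite -[a *: y]mul_malgC -[a *: (x * y)]mul_malgC !mulrA; congr (_ * _).
rewrite !malgM_def fgmulUg fgmulgU.
by apply: eq_bigr => k _; rewrite mulrC mul1m mulm1.
Qed.
HB.instance Definition _ := GRing.Lalgebra_isAlgebra.Build K free_alg free_scaleAr.

Definition free_var (i : I) : free_alg := mkmalgU (fmu i) 1.

Variable c : I -> K.
Definition free_word (m : {fmonom I}) : K := \prod_(i <- m) c i.
Fact free_word_mul : mmorphism free_word.
Proof.
split=> [x y|]; first by rewrite /free_word fmM big_cat.
by rewrite /free_word fm1 big_nil.
Qed.
HB.instance Definition _ := isMultiplicative.Build {fmonom I} K free_word free_word_mul.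

Definition free_eval : {lrmorphism free_alg -> K^o} :=
  [the {lrmorphism free_alg -> K^o} of mmap idfun free_word].

Lemma free_evalE i : free_eval (free_var i) = c i.
Proof. by rewrite /= mmapU /= mul1r /free_word fmU big_seq1. Qed.

End FreeAlgebra.

(* U_rs is U_{r,s}(sl_n), and u_rs is its restricted quotient u_{r,s}(sl_n)
   for the exponent l.  All indices are 0-based: i : 'I_n.-1
   stands for the index i + 1 of the usual 1-based notation. *)

Definition eps (n i : nat) : 'rV[int]_n := \row_(k < n) ((k == i :> nat)%:R).
Definition alpha (n j : nat) : 'rV[int]_n := eps n j - eps n j.+1.
Definition dot (n : nat) (a b : 'rV[int]_n) : int := \sum_k a 0 k * b 0 k.

(* gen_wV and gen_w'V are the inverses of gen_w and gen_w'. *)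
Inductive qgen (m : nat) : Type :=
| gen_e of 'I_m | gen_f of 'I_m
| gen_w of 'I_m | gen_wV of 'I_m | gen_w' of 'I_m | gen_w'V of 'I_m.

HB.instance Definition _ m := gen_eqMixin (qgen m).
HB.instance Definition _ m := gen_choiceMixin (qgen m).

Definition is_toral m (g : qgen m) : bool :=
  match g with gen_e _ | gen_f _ => false | _ => true end.

(* root_vector c g i j, for j <= i, is g_j if i = j and
   g_i E_{i-1,j} - c E_{i-1,j} g_i if i > j. *)
Fixpoint root_vector (K : fieldType) (A : algType K) (m : nat) (c : K)
    (g : 'I_m -> A) (i j : nat) : A :=
  let gi := if insub i is Some o then g o else 0 in
  if i is i'.+1 then
    if (i <= j)%N then gi
    else gi * root_vector c g i' j - c *: (root_vector c g i' j * gi)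
  else gi.

Section QuantumGroup.
Variables (K : fieldType) (n : nat) (r s : K).
Local Notation I := 'I_n.-1.

Section Relations.
Variables (A : algType K) (var : qgen n.-1 -> A).
Local Notation e i := (var (gen_e i)).
Local Notation f i := (var (gen_f i)).
Local Notation w i := (var (gen_w i)).
Local Notation w' i := (var (gen_w' i)).
Local Notation wV i := (var (gen_wV i)).
Local Notation w'V i := (var (gen_w'V i)).
Local Notation ip i j := (dot (eps n i) (alpha n j)).

(* The elements x - y for the defining relations x = y. *)
Inductive U_rel : A -> Prop :=
| R1_comm g h : is_toral g -> is_toral h ->
    U_rel (var g * var h - var h * var g)
| R1_w i : U_rel (w i * wV i - 1)
| R1_w' i : U_rel (w' i * w'V i - 1)
| R2_e (i j : I) :
    U_rel (w i * e j - (r ^ ip i j * s ^ ip i.+1 j) *: (e j * w i))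
| R2_f (i j : I) :
    U_rel (w i * f j - (r ^ (- ip i j) * s ^ (- ip i.+1 j)) *: (f j * w i))
| R3_e (i j : I) :
    U_rel (w' i * e j - (r ^ ip i.+1 j * s ^ ip i j) *: (e j * w' i))
| R3_f (i j : I) :
    U_rel (w' i * f j - (r ^ (- ip i.+1 j) * s ^ (- ip i j)) *: (f j * w' i))
| R4 (i j : I) :
    U_rel (e i * f j - f j * e i - ((i == j)%:R / (r - s)) *: (w i - w' i))
| R5_e (i j : I) : (1 < `|i%:Z - j%:Z|)%N -> U_rel (e i * e j - e j * e i)
| R5_f (i j : I) : (1 < `|i%:Z - j%:Z|)%N -> U_rel (f i * f j - f j * f i)
| R6_l (i j : I) : j = i.+1 :> nat ->
    U_rel (e i ^+ 2 * e j - (r + s) *: (e i * e j * e i)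
           + (r * s) *: (e j * e i ^+ 2))
| R6_r (i j : I) : j = i.+1 :> nat ->
    U_rel (e i * e j ^+ 2 - (r + s) *: (e j * e i * e j)
           + (r * s) *: (e j ^+ 2 * e i))
| R7_l (i j : I) : j = i.+1 :> nat ->
    U_rel (f i ^+ 2 * f j - (r^-1 + s^-1) *: (f i * f j * f i)
           + (r^-1 * s^-1) *: (f j * f i ^+ 2))
| R7_r (i j : I) : j = i.+1 :> nat ->
    U_rel (f i * f j ^+ 2 - (r^-1 + s^-1) *: (f j * f i * f j)
           + (r^-1 * s^-1) *: (f j ^+ 2 * f i)).


Definition E_ (i j : nat) : A := root_vector r^-1 (fun k => e k) i j.
Definition F_ (i j : nat) : A := root_vector s (fun k => f k) i j.

Inductive u_rel (l : nat) : A -> Prop :=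
| rel_E (i j : I) : (j <= i)%N -> u_rel l (E_ i j ^+ l)
| rel_F (i j : I) : (j <= i)%N -> u_rel l (F_ i j ^+ l)
| rel_w i : u_rel l (w i ^+ l - 1)
| rel_w' i : u_rel l (w' i ^+ l - 1).

Definition gen_counit (g : qgen n.-1) : K := (is_toral g)%:R.

Variable phi : {lrmorphism A -> K^o}.
Hypothesis phiE : forall g, phi (var g) = gen_counit g.

Lemma U_rel_counit p : U_rel p -> phi p = 0.
Proof.
have pD x y : phi (x + y) = phi x + phi y :> K by exact: rmorphD.
have pN x : phi (- x) = - phi x :> K by exact: rmorphN.
have pZ k x : phi (k *: x) = k * phi x :> K by rewrite linearZ.
have pM x y : phi (x * y) = phi x * phi y :> K by exact: rmorphM.
have p1 : phi 1 = 1 :> K by exact: rmorph1.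
case=> [g h tg th|i|i|i j|i j|i j|i j|i j|i j _|i j _|i j _|i j _|i j _|i j _];
  rewrite ?expr2 !(pD, pN, pZ, pM, p1, phiE) /gen_counit /= ?tg ?th;
  by rewrite ?(mulr0, mul0r, mulr1, oppr0, addr0, subrr).
Qed.

Lemma root_vector_counit c (g : I -> A) i j :
  (forall k, phi (g k) = 0) -> phi (root_vector c g i j) = 0.
Proof.
move=> g0; have gi0 k : phi (if insub k is Some o then g o else 0) = 0.
  by case: insub => [o|]; rewrite ?g0 ?rmorph0.
elim: i => [|i IH] /=; first exact: gi0.
case: ifP => _; first exact: gi0.
by rewrite rmorphB /= linearZ !rmorphM /= !gi0 mul0r mulr0 scaler0 subr0.
Qed.

Lemma u_rel_counit l p : (0 < l)%N -> u_rel l p -> phi p = 0.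
Proof.
case: l => // l _; case=> [i j _|i j _|i|i].
- by rewrite rmorphXn /= root_vector_counit ?expr0n // => k; apply: phiE.
- by rewrite rmorphXn /= root_vector_counit ?expr0n // => k; apply: phiE.
- by rewrite rmorphB rmorphXn /= phiE rmorph1 expr1n subrr.
- by rewrite rmorphB rmorphXn /= phiE rmorph1 expr1n subrr.
Qed.

End Relations.

Definition F_free : algType K := free_alg K (qgen n.-1).
Definition F_gen (g : qgen n.-1) : F_free := free_var K g.

Definition Uaug : augmentation (U_rel F_gen) :=
  Augmentation (U_rel_counit (free_evalE gen_counit)).

Definition U_rs : algType K := quot_alg Uaug.
Definition U_gen (g : qgen n.-1) : U_rs := quot_pi Uaug (F_gen g).
Definition U_counit : {lrmorphism U_rs -> K^o} :=
  [the {lrmorphism quot_alg Uaug -> K^o} of quot_aug (e := Uaug)].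

Lemma U_counitE g : U_counit (U_gen g) = gen_counit g.
Proof. by rewrite -(free_evalE gen_counit g); apply: quot_augE. Qed.

Section Restricted.
Variables (l : nat) (l_gt0 : (0 < l)%N).

Definition uaug : augmentation (u_rel U_gen l) :=
  Augmentation (fun p => @u_rel_counit _ _ U_counit U_counitE l p l_gt0).

Definition u_rs : algType K := quot_alg uaug.
Definition u_gen (g : qgen n.-1) : u_rs := quot_pi uaug (U_gen g).

End Restricted.

(* The Hopf-theoretic notions are stated for an algebra A with generators x;
   they are meant for A = u_rs and x = u_gen. *)
Section HopfModules.
Variables (A : algType K) (x : qgen n.-1 -> A).
Local Notation e i := (x (gen_e i)).
Local Notation f i := (x (gen_f i)).
Local Notation w i := (x (gen_w i)).
Local Notation w' i := (x (gen_w' i)).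

(* These values determine the Hopf structure, since the e i, f i, w i, w' i
   and the inverses of the w i, w' i generate. *)
Definition is_quantum_hopf (HA : hopf_structure A) : Prop :=
  forall i,
  [/\ comul HA (w i) = tens (w i) (w i) /\ counit HA (w i) = 1,
      comul HA (w' i) = tens (w' i) (w' i) /\ counit HA (w' i) = 1,
      comul HA (e i) = tens (e i) 1 + tens (w i) (e i) /\ counit HA (e i) = 0
    & comul HA (f i) = tens 1 (f i) + tens (f i) (w' i)
      /\ counit HA (f i) = 0].

(* b' is generated by the w' i and f i; in the restricted quantum group it
   contains the inverses of the w' i, as w' i ^+ l = 1. *)
Definition b'_gen (a : A) : Prop := exists i, a = w' i \/ a = f i.
Definition b' : algType K := gen_subalg b'_gen.
Definition b'_val : b' -> A := @subalg_val K A b'_gen.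

Fact b'_gen_w' i : b'_gen (w' i). Proof. by exists i; left. Qed.
Fact b'_gen_f i : b'_gen (f i). Proof. by exists i; right. Qed.
Definition bw' i : b' := subalg_in (b'_gen_w' i).
Definition bf i : b' := subalg_in (b'_gen_f i).

(* H is the Hopf algebra (b')^coop: the algebra b' with the opposite of the
   comultiplication inherited from A. *)
Definition is_b'_coop (HA : hopf_structure A) (H : hopf_structure b') : Prop :=
  (forall h, tmap b'_val b'_val (comul H h) = tswap (comul HA (b'_val h)))
  /\ (forall h, counit H h = counit HA (b'_val h)).

(* pw i and pe i are the functionals <omega_i, -> and <e_i, -> on H. *)
Definition is_pairing (H : hopf_structure b')
    (pw : I -> {lrmorphism b' -> K^o}) (pe : I -> {linear b' -> K^o}) : Prop :=
  [/\ forall i j : I, pw i (bw' j)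
        = r ^ dot (eps n i) (alpha n j) * s ^ dot (eps n i.+1) (alpha n j),
      forall i j : I, pw i (bf j) = 0,
      forall (i : I) a b,
        pe i (a * b) = pe i a * counit H b + pw i a * pe i b,
      forall i j : I, pe i (bw' j) = 0
    & forall i j : I, pe i (bf j) = (i == j)%:R / (s - r)].

(* M, embedded in H by j, is the A-module H *_beta g: its underlying space is
   {h *_beta g : h in H}, the elements of b' act by *_beta and the w i, e i
   act through the pairings. *)
Record is_bullet_module (H : hopf_structure b') (Sinv : b' -> b')
    (pw : I -> {lrmorphism b' -> K^o}) (pe : I -> {linear b' -> K^o})
    (beta : {lrmorphism b' -> K^o}) (g : b')
    (M : lmodType A) (j : M -> b') : Prop := {
  bullet_inj : injective j;
  bullet_linear : forall (k : K) m m', j (k%:A *: m + m') = k *: j m + j m';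
  bullet_image : forall b,
    (exists m, j m = b) <-> (exists h, bullet H Sinv beta h g = b);
  bullet_H : forall h m, j (b'_val h *: m) = bullet H Sinv beta h (j m);
  bullet_w : forall i m, j (w i *: m) = coact H (pw i) (j m);
  bullet_e : forall i m, j (e i *: m) = coact H (pe i) (j m)
}.

End HopfModules.
End QuantumGroup.

Definition Amx (m : nat) (y z : int) : 'M[int]_m :=
  \matrix_(i, j) (if j == i :> nat then y - z
                  else if j == i.+1 :> nat then z
                  else if i == j.+1 :> nat then - y else 0).

(* Main.v *)
Require Import Defs.
From HB Require Import structures.
From mathcomp Require Import all_boot all_order all_algebra.
From mathcomp Require Import boolp classical_sets monalg ring zify.

Set Implicit Arguments.
Unset Strict Implicit.
Unset Printing Implicit Defensive.

Import GRing.Theory.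

Local Open Scope ring_scope.

(**
A character chi of u_{r,s}(sl_n) is constrained on the generators one at a
time.  The relation w_i e_i = r s^-1 e_i w_i together with r != s and the
invertibility of chi(w_i) forces chi(e_i) = 0, and chi(f_i) = 0 in the same
way; the commutator [e_i, f_i] then gives chi(w_i) = chi(w'_i), an l-th root
of unity because w_i^l = 1 ([char_e], [char_f], [char_w'], [char_value]).

For the second part the point is that H . g is the line K g.  Write
g = prod_j w'_j^(d_j).  In H = (b')^coop the w'_i are group-like and
Delta(f_i) = f_i (x) 1 + w'_i (x) f_i, so that S^-1(f_i) = - f_i S^-1(w'_i) and,
as chi(f_i) = 0,
  w'_i . g = chi(w'_i) g,   f_i . g = (chi(w'_i) f_i g - g f_i) S^-1(w'_i).
Moving f_i across g multiplies it by theta to the power sum_j A_ij d_j, and the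
same power of theta is the value of <w_i, -> on the group-like element g.
The choice d = A^-1 (chi_1, ..., chi_(n-1)) makes both of them equal to
theta^(chi_i) = chi(w_i): hence f_i kills g and w_i acts on g by chi(w_i), while
e_i kills g because <e_i, -> is a skew derivation that vanishes on every w'_j.
The dot is an action of the algebra H ([bulletM]), so h . g = chi(h) g for
every h as soon as this holds for generators ([bullet_eigen]), and the module
on H . g is K_chi ([bullet_char_module], [bullet_module_char]).

Four facts support this computation.  The coproduct of b' is only prescribed
after inclusion in the coproduct of the whole algebra, so one needs that the
tensor square of an injection of vector spaces is injective; a linear
retraction, obtained from Zorn's lemma, settles it ([linear_retraction],
[tmap_inj]).  The action law needs the antipode to reverse products
([antipodeM]).  The matrix A is invertible modulo l because its determinant
satisfies D_(m+2) = (y - z) D_(m+1) + y z D_m ([det_Amx]).  Finally e_i, f_i,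
w_i, w'_i generate the restricted quantum group ([u_rs_gen]), which makes a
module structure determined by their action.
*)

(** * Tensor products of injective linear maps *)

(** A maximal subspace C meeting the image of f only in 0 is a complement of
that image: otherwise some w outside C + f(V) could be added to C.  The
retraction sends w to the unique v with w - f v in C. *)
Lemma linear_retraction (K : fieldType) (V W : lmodType K)
    (f : {linear V -> W}) :
  injective f -> exists2 rho : W -> V, linear rho & cancel f rho.
Proof.
move=> f_inj.
pose closedP (C : set W) := forall k x y, C x -> C y -> C (k *: x + y).
pose P : set (set W) := fun C => closedP C /\ forall v, C (f v) -> v = 0.
have [F FP Ftot|C [[Ccl Cf] Cmax]] := @Zorn_bigcup W P.
  split=> [k x y [X FX Xx] [Y FY Yy]|v [X FX]];
    last by have [_ Xf] := FP X FX => Xv; apply: Xf.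
  have [[Xcl _] [Ycl _]] := (FP X FX, FP Y FY).
  have [XY|YX] := Ftot X Y FX FY.
    by exists Y => //; apply: Ycl => //; apply: XY.
  by exists X => //; apply: Xcl => //; apply: YX.
(* The empty set satisfies P, so C need not contain 0. *)
pose C0 x := C x \/ x = 0.
have C0cl : closedP C0.
  move=> k x y [Cx|->] [Cy|->]; rewrite /C0 ?scaler0 ?add0r ?addr0; auto.
  by left; rewrite -[k](subrK 1) scalerDl scale1r; apply: Ccl.
have C0f v : C0 (f v) -> v = 0.
  by move=> [/Cf //|fv0]; apply: f_inj; rewrite fv0 linear0.
have C0Z k x : C0 x -> C0 (k *: x).
  by move=> Cx; rewrite -[_ *: _]addr0; apply: C0cl => //; right.
have C0B x y : C0 x -> C0 y -> C0 (x - y).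
  by move=> Cx Cy; rewrite addrC -scaleN1r; apply: C0cl.
have split_w w : exists v, C0 (w - f v).
  apply: contrapT => noV.
  pose C' : set W := fun u => exists k c, C0 c /\ u = k *: w + c.
  apply: (Cmax C').
    split=> [c Cc|CC'].
      by exists 0, c; rewrite scale0r add0r; split=> //; left.
    apply: noV; exists 0; rewrite linear0 subr0; left; apply: CC'.
    by exists 1, 0; rewrite scale1r addr0; split=> //; right.
  split=> [k _ _ [a [c [Cc ->]]] [b [d [Cd ->]]]|v [k [c [Cc fvE]]]].
    exists (k * a + b), (k *: c + d); split; first exact: C0cl.
    by rewrite scalerDr scalerA addrACA scalerDl.
  have [k0|k_neq0] := eqVneq k 0.
    by apply: C0f; rewrite fvE k0 scale0r add0r.
  case: noV; exists (k^-1 *: v).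
  rewrite linearZ /= fvE scalerDr scalerA mulVf // scale1r opprD addNKr
    -scalerN.
  by rewrite -[- c]scaleN1r; apply/C0Z/C0Z.
have [rho rhoP] := choice split_w.
have rho_uniq w v : C0 (w - f v) -> rho w = v.
  move=> Cv; apply/eqP; rewrite -subr_eq0; apply/eqP/C0f.
  by have := C0B _ _ Cv (rhoP w); rewrite (linearB f) opprB addrC addrA subrK.
exists rho => [k u v|v]; apply: rho_uniq; last by rewrite subrr; right.
rewrite linearP opprD addrACA -scalerBr.
exact: C0cl.
Qed.

Section TensorLemmas.
Variables (K : fieldType) (V W : lmodType K).

Lemma tlift0 (M : lmodType K) (f : V -> W -> M) : bilin f -> tlift f 0 = 0.
Proof.
move=> /tlift_linear fl; have := fl (-1) 0 0.
by rewrite scaler0 add0r scaleN1r addNr.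
Qed.

Lemma tliftD (M : lmodType K) (f : V -> W -> M) x y :
  bilin f -> tlift f (x + y) = tlift f x + tlift f y.
Proof. by move=> /tlift_linear fl; have := fl 1 x y; rewrite !scale1r. Qed.

Lemma tlift_sum (M : lmodType K) (f : V -> W -> M) I (r : seq I) F :
  bilin f -> tlift f (\sum_(i <- r) F i) = \sum_(i <- r) tlift f (F i).
Proof.
by move=> fB; apply: (big_morph (tlift f)) => [x y|]; rewrite ?tlift0 ?tliftD.
Qed.

Lemma tmap_bilin (V' W' : lmodType K) (f : V -> V') (g : W -> W') :
  linear f -> linear g -> bilin (fun v w => tens (f v) (g w)).
Proof.
have [tl tr] := bilin_tens V' W'.
by move=> fl gl; split=> [w k v v'|v k w w']; rewrite ?fl ?gl ?tl ?tr.
Qed.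

Lemma tswap_bilin : bilin (fun (v : V) (w : W) => tens w v).
Proof.
have [tl tr] := bilin_tens W V.
by split=> [w k v v'|v k w w'] /=; rewrite ?tl ?tr.
Qed.

Lemma tswap_tens (v : V) (w : W) : tswap (tens v w) = tens w v.
Proof. by rewrite /tswap tlift_tens //; apply: tswap_bilin. Qed.

Lemma tswapD (x y : tensor V W) : tswap (x + y) = tswap x + tswap y.
Proof. by rewrite /tswap tliftD //; apply: tswap_bilin. Qed.

End TensorLemmas.

(** Retractions of f and g induce a retraction of their tensor product. *)
Lemma tmap_inj (K : fieldType) (V W V' W' : lmodType K)
    (f : {linear V -> V'}) (g : {linear W -> W'}) :
  injective f -> injective g -> injective (tmap f g).
Proof.
move=> /linear_retraction[rho rhol fK] /linear_retraction[sig sigl gK].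
apply: (can_inj (g := tmap rho sig)) => x; rewrite {2}/tmap /tlift /tsum.
rewrite /tmap tlift_sum; last exact: tmap_bilin.
rewrite -[RHS]tens_reprK tens_piE; apply: eq_bigr => p _.
by rewrite tlift_tens ?fK ?gK //; apply: tmap_bilin.
Qed.

(** * Sweedler calculus and the antipode *)

Lemma linear_combP (K : fieldType) (V W : lmodType K) (f : V -> W) I
    (r : seq I) (k : I -> K) (F : I -> V) : linear f ->
  f (\sum_(i <- r) k i *: F i) = \sum_(i <- r) k i *: f (F i).
Proof.
move=> fl; elim: r => [|i r IH]; last by rewrite !big_cons fl IH.
rewrite !big_nil; have := fl (-1) 0 0.
by rewrite scaler0 add0r scaleN1r addNr.
Qed.

(* Closes goals stating that an explicit expression is linear in one of its
   arguments. *)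
Local Ltac lin := by rewrite ?(mulrDl, mulrDr, linearD, linearZ, scalerDr,
  =^~ scalerAl, =^~ scalerAr, scalerA) /= ?(mulrDl, mulrDr,  linearD, linearZ,
  scalerDr, =^~ scalerAl, =^~ scalerAr).

Section Sweedler.
Variables (K : fieldType) (A : algType K) (H : hopf_structure A).
Local Notation S := (antipode H).
Local Notation eps x := (counit H x : K).

(** Pairs (x_(1), x_(2)) representing the coproduct, so that Sweedler sums
become ordinary iterated sums to which the big operator lemmas apply. *)
Definition sweedler (x : A) : seq (A * A) := tens_repr (comul H x).
Local Notation D := sweedler.

Definition trilin (M : lmodType K) (f : A -> A -> A -> M) : Prop :=
  [/\ forall b c, linear (fun a => f a b c),
      forall a c, linear (fun b => f a b c)
    & forall a b, linear (f a b)].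

Lemma sweedlerE (M : lmodType K) (f : A -> A -> M) x :
  \sum_(p <- D x) f p.1 p.2 = tlift f (comul H x).
Proof. by []. Qed.

Lemma sweedlerM (M : lmodType K) (f : A -> A -> M) x y : bilin f ->
  \sum_(p <- D (x * y)) f p.1 p.2
  = \sum_(p <- D x) \sum_(q <- D y) f (p.1 * q.1) (p.2 * q.2).
Proof.
move=> fB; rewrite sweedlerE comulM -(tens_reprK (comul H x)).
by rewrite -(tens_reprK (comul H y)) [_ * _]tens_mulE tlift_pi // tsum_mul.
Qed.

Lemma sweedlerA (M : lmodType K) (f : A -> A -> A -> M) x : trilin f ->
  \sum_(p <- D x) \sum_(q <- D p.1) f q.1 q.2 p.2
  = \sum_(p <- D x) \sum_(q <- D p.2) f p.1 q.1 q.2.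
Proof.
move=> [f1 f2 f3].
have fB a : bilin (f a) by split=> *; [apply: f2|apply: f3].
pose F a (t : tensor A A) := tlift (f a) t.
have FB : bilin F.
  split=> [t k a b|a]; last exact: tlift_linear.
  rewrite /F /tlift /tsum scaler_sumr -big_split /=.
  by apply: eq_bigr => p _; rewrite f1.
have := congr1 (tlift F) (comulA H x); rewrite -!sweedlerE !tlift_sum //=.
under eq_bigr => p _ do rewrite -sweedlerE tlift_sum //.
under eq_bigr => p _ do under eq_bigr => q _ do
  rewrite tlift_tens // /F tlift_tens //.
move=> ->; apply: eq_bigr => p _; by rewrite tlift_tens.
Qed.

Lemma sweedler_counitl (M : lmodType K) (f : A -> M) x : linear f ->
  \sum_(p <- D x) eps p.1 *: f p.2 = f x.
Proof.
by move=> fl; rewrite -(linear_combP _ (fun p : A * A => eps p.1)) //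
  [in X in f X](sweedlerE (fun a b => eps a *: b)) comul_counitl.
Qed.

Lemma sweedler_counitr (M : lmodType K) (f : A -> M) x : linear f ->
  \sum_(p <- D x) eps p.2 *: f p.1 = f x.
Proof.
by move=> fl; rewrite -(linear_combP _ (fun p : A * A => eps p.2)) //
  [in X in f X](sweedlerE (fun a b => eps b *: a)) comul_counitr.
Qed.

Lemma sweedler_antipodel x : \sum_(p <- D x) S p.1 * p.2 = (eps x)%:A.
Proof. exact: comul_antipodel. Qed.

Lemma sweedler_antipoder x : \sum_(p <- D x) p.1 * S p.2 = (eps x)%:A.
Proof. exact: comul_antipoder. Qed.

(** The two sides are evaluated from the same sum
S(x_(1) y_(1)) x_(2) y_(2) S(y_(3)) S(x_(3)): collapsing the first four factors
leaves S(y) S(x), collapsing y_(2) S(y_(3)) and then x_(2) S(x_(3)) leaves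
S(x y). *)
Lemma antipodeM x y : S (x * y) = S y * S x.
Proof.
transitivity (\sum_(p <- D x) \sum_(p' <- D p.1) \sum_(q <- D y)
  \sum_(q' <- D q.1) S (p'.1 * q'.1) * (p'.2 * q'.2) * (S q.2 * S p.2)).
  rewrite (@sweedlerA _ (fun a b c => \sum_(q <- D y) \sum_(q' <- D q.1)
    S (a * q'.1) * (b * q'.2) * (S q.2 * S c))); last first.
    split=> [b c|a c|a b] k u v; rewrite scaler_sumr -big_split /=;
    apply: eq_bigr => q _; rewrite scaler_sumr -big_split /=;
    apply: eq_bigr => q' _; lin.
  transitivity (\sum_(p <- D x) \sum_(p' <- D p.2)
    S (p.1 * y) * p'.1 * S p'.2); last first.
    apply: eq_bigr => p _; apply: eq_bigr => p' _.
    rewrite (@sweedlerA _ (fun a b c =>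
      S (p.1 * a) * (p'.1 * b) * (S c * S p'.2))); last first.
      by split=> [b c|a c|a b] k u v; lin.
    rewrite -(@sweedler_counitr _ (fun u => S (p.1 * u) * p'.1 * S p'.2));
      last by move=> k u v; lin.
    apply: eq_bigr => q _.
    transitivity (S (p.1 * q.1) * p'.1
                  * (\sum_(q' <- D q.2) q'.1 * S q'.2) * S p'.2).
      by rewrite sweedler_antipoder -scalerAr mulr1 -scalerAl.
    by rewrite mulr_sumr mulr_suml; apply: eq_bigr => q' _; rewrite !mulrA.
  rewrite -(@sweedler_counitr _ (fun u => S (u * y)));
    last by move=> k u v; lin.
  apply: eq_bigr => p _.
  transitivity (S (p.1 * y) * (\sum_(p' <- D p.2) p'.1 * S p'.2)).
    by rewrite sweedler_antipoder -scalerAr mulr1.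
  by rewrite mulr_sumr; apply: eq_bigr => p' _; rewrite !mulrA.
transitivity (\sum_(p <- D x) \sum_(q <- D y)
  eps p.1 *: (eps q.1 *: (S q.2 * S p.2))).
  apply: eq_bigr => p _; rewrite exchange_big; apply: eq_bigr => q _ /=.
  rewrite scalerA -[_ * _ in RHS](rmorphM (counit H)) -[RHS]mulr_algl.
  rewrite -[X in _ = X * _]sweedler_antipodel.
  rewrite (@sweedlerM _ (fun a b => S a * b)); last by split=> [b|a] k u v; lin.
  rewrite mulr_suml; apply: eq_bigr => p' _.
  by rewrite mulr_suml; apply: eq_bigr => q' _.
rewrite -(@sweedler_counitl _ (fun u => S y * S u)); last by move=> k u v; lin.
apply: eq_bigr => p _; rewrite -scaler_sumr; congr (_ *: _).
by rewrite (@sweedler_counitl _ (fun u => S u * S p.2)) // => k u v; lin.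
Qed.

End Sweedler.

(** * The twisted adjoint action *)

Section Bullet.
Variables (K : fieldType) (A : algType K) (H : hopf_structure A).
Variables (Sinv : A -> A) (beta : {lrmorphism A -> K^o}).
Local Notation S := (antipode H).
Local Notation D := (sweedler H).
Hypotheses (SK : cancel S Sinv) (SinvK : cancel Sinv S).
Local Notation bul := (bullet H Sinv beta).

Lemma antipode1 : S 1 = 1.
Proof.
have := comul_antipodel H 1; rewrite comul1 tlift_tens ?mulr1.
  by rewrite rmorph1 scale1r.
by split=> [b|a] k u v; lin.
Qed.

Lemma Sinv_linear : linear Sinv.
Proof. by move=> k u v; apply: (can_inj SK); rewrite (linearP S) !SinvK. Qed.

Lemma SinvM u v : Sinv (u * v) = Sinv v * Sinv u.
Proof. by apply: (can_inj SK); rewrite antipodeM !SinvK. Qed.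

Lemma Sinv1 : Sinv 1 = 1.
Proof. by apply: (can_inj SK); rewrite SinvK antipode1. Qed.

Lemma bullet_trilin b :
  trilin (fun h1 h2 h3 => (beta h2 : K) *: (h3 * b * Sinv h1)).
Proof.
split=> [h2 h3|h1 h3|h1 h2] k u v.
- by rewrite Sinv_linear mulrDr scalerDr -scalerAr !scalerA mulrC.
- by rewrite /= linearD linearZ /= scalerDl scalerA.
- by rewrite !mulrDl -!scalerAl scalerDr !scalerA mulrC.
Qed.

Lemma bullet_bilin b : bilin (fun h12 h3 =>
  tlift (fun h1 h2 => (beta h2 : K) *: (h3 * b * Sinv h1)) (comul H h12)).
Proof.
have [t1 t2 t3] := bullet_trilin b; split=> [h3|h12] k u v.
  by rewrite linearP tlift_linear.
rewrite /= /tlift /tsum scaler_sumr -big_split /=.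
by apply: eq_bigr => q _; apply: t3.
Qed.

Lemma bullet_linearl b : linear (bul^~ b).
Proof.
move=> k u v /=; rewrite /bullet linearP tlift_linear //.
exact: bullet_bilin.
Qed.

Lemma bullet_linearr h : linear (bul h).
Proof.
move=> k u v; rewrite /bullet /tlift /tsum scaler_sumr -big_split /=.
apply: eq_bigr => p _; rewrite scaler_sumr -big_split /=; apply: eq_bigr => q _.
by rewrite mulrDr mulrDl -scalerAr -scalerAl scalerDr !scalerA mulrC.
Qed.

(** The coproduct and beta are multiplicative and Sinv reverses products, so
the factors coming from h surround those coming from h'. *)
Lemma bulletM h h' b : bul (h * h') b = bul h (bul h' b).
Proof.
transitivity (\sum_(p <- D h) \sum_(p' <- D h') \sum_(q <- D p.1)
    \sum_(q' <- D p'.1) (beta (q.2 * q'.2) : K) *: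
      (p.2 * p'.2 * b * Sinv (q.1 * q'.1))).
  apply: etrans (sweedlerM H h h' (bullet_bilin b)) _.
  apply: eq_bigr => p _; apply: eq_bigr => p' _.
  have [t1 t2 _] := bullet_trilin b.
  apply: (@sweedlerM _ _ H _ (fun h1 h2 =>
    (beta h2 : K) *: (p.2 * p'.2 * b * Sinv h1))).
  by split=> [u|u]; [apply: t1|apply: t2].
rewrite /bullet -sweedlerE; apply: eq_bigr => p _; rewrite exchange_big.
apply: eq_bigr => q _; rewrite mulr_sumr mulr_suml scaler_sumr.
apply: eq_bigr => p' _; rewrite mulr_sumr mulr_suml scaler_sumr.
apply: eq_bigr => q' _; rewrite rmorphM SinvM /= -scalerA.
by rewrite -scalerAr -scalerAl !mulrA.
Qed.

Lemma bullet1 b : bul 1 b = b.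
Proof.
rewrite /bullet comul1 tlift_tens; last exact: bullet_bilin.
have [t1 t2 _] := bullet_trilin b.
rewrite comul1 tlift_tens; last by split=> [h2|h1]; [apply: t1|apply: t2].
by rewrite rmorph1 scale1r mul1r Sinv1 mulr1.
Qed.

Lemma mul_Sinv_grouplike w :
  comul H w = tens w w -> counit H w = 1 -> w * Sinv w = 1.
Proof.
move=> Dw ew; have := comul_antipoder H w; rewrite Dw tlift_tens; last first.
  by split=> [b|a] k u v; lin.
by rewrite ew scale1r => /(congr1 Sinv); rewrite SinvM SK Sinv1.
Qed.

Lemma bullet_grouplike w b : comul H w = tens w w ->
  bul w b = (beta w : K) *: (w * b * Sinv w).
Proof.
have [t1 t2 _] := bullet_trilin b.
move=> Dw; rewrite /bullet Dw tlift_tens; last exact: bullet_bilin.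
by rewrite Dw tlift_tens.
Qed.

(** The antipode axiom for f reads f + w S(f) = 0; apply Sinv, which reverses
products. *)
Lemma Sinv_skew f w : comul H f = tens f 1 + tens w f -> counit H f = 0 ->
  Sinv f = - (f * Sinv w).
Proof.
have mB : bilin (fun a b : A => a * S b) by split=> [b|a] k u v; lin.
move=> Df ef; have := comul_antipoder H f; rewrite Df tliftD // !tlift_tens //.
rewrite antipode1 mulr1 ef scale0r => /eqP; rewrite addr_eq0 => /eqP fE.
rewrite {1}fE -scaleN1r (scalable_linear Sinv_linear) SinvM SK.
by rewrite /= scaleN1r.
Qed.

(** Iterating the coproduct of f gives f (x) 1 (x) 1 + w (x) f (x) 1
+ w (x) w (x) f; the middle term is killed by beta, and Sinv f = - f Sinv w in
the first one. *)
Lemma bullet_skew f w b :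
  comul H w = tens w w -> comul H f = tens f 1 + tens w f -> counit H f = 0 ->
  beta f = 0 ->
  bul f b = ((beta w : K) *: (f * b) - b * f) * Sinv w.
Proof.
move=> Dw Df ef bf0; rewrite /bullet Df tliftD ?tlift_tens;
  try exact: bullet_bilin.
have hB h3 : bilin (fun h1 h2 => (beta h2 : K) *: (h3 * b * Sinv h1)).
  have [t1 t2 _] := bullet_trilin b.
  by split=> [h2|h1]; [apply: t1|apply: t2].
rewrite Dw Df tliftD ?tlift_tens // bf0 scale0r addr0 rmorph1 scale1r mul1r.
by rewrite (Sinv_skew Df ef) mulrBl -scalerAl addrC mulrN !mulrA.
Qed.

End Bullet.

Lemma coact_bilin (K : fieldType) (A : algType K) (phi : {linear A -> K^o}) :
  bilin (fun a b : A => (phi b : K) *: a).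
Proof.
split=> [b|a] k u v /=; last by rewrite linearD linearZ /= scalerDl scalerA.
by rewrite scalerDr !scalerA mulrC.
Qed.

Lemma coact_linear (K : fieldType) (A : algType K) (H : hopf_structure A)
  (phi : {linear A -> K^o}) : linear (coact H phi).
Proof.
move=> k u v; rewrite /coact linearP tlift_linear //.
exact: coact_bilin.
Qed.

Lemma coact_grouplike (K : fieldType) (A : algType K) (H : hopf_structure A)
  (phi : {linear A -> K^o}) g :
  comul H g = tens g g -> coact H phi g = (phi g : K) *: g.
Proof.
move=> Dg; rewrite /coact Dg tlift_tens //.
exact: coact_bilin.
Qed.

(** * Generated subalgebras *)

Lemma gen_subalg_ind (K : fieldType) (A : algType K) (X : A -> Prop)
    (P : gen_subalg X -> Prop) :
  (forall x (Xx : X x), P (subalg_in Xx)) -> P 1 ->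
  (forall k a b, P a -> P b -> P (k *: a + b)) ->
  (forall a b, P a -> P b -> P (a * b)) -> forall a, P a.
Proof.
move=> Pin P1 PD PM [a aX]; have /asboolP aG := aX.
elim: {a} aG aX => [a Xa|| k a b aG IHa bG IHb|a b aG IHa bG IHb] abX.
- rewrite (_ : exist _ _ _ = subalg_in Xa :> gen_subalg X) //.
  exact: val_inj.
- by rewrite (_ : exist _ _ _ = 1 :> gen_subalg X) //; apply: val_inj.
- have [aX bX] : a \in subalg_pred X /\ b \in subalg_pred X.
    by split; apply/asboolP.
  rewrite (_ : exist _ _ _ =
    k *: (exist _ a aX : gen_subalg X) + exist _ b bX :> gen_subalg X).
    exact: PD.
  exact: val_inj.
- have [aX bX] : a \in subalg_pred X /\ b \in subalg_pred X.
    by split; apply/asboolP.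
  rewrite (_ : exist _ _ _ =
    (exist _ a aX : gen_subalg X) * exist _ b bX :> gen_subalg X).
    exact: PM.
  exact: val_inj.
Qed.

(** The elements acting on g through beta form a subalgebra, because the bullet
is an action. *)
Lemma bullet_eigen (K : fieldType) (A : algType K) (X : A -> Prop)
    (H : hopf_structure (gen_subalg X)) (Sinv : gen_subalg X -> gen_subalg X)
    (beta : {lrmorphism gen_subalg X -> K^o}) (g : gen_subalg X) :
  cancel (antipode H) Sinv -> cancel Sinv (antipode H) ->
  (forall a (Xa : X a), bullet H Sinv beta (subalg_in Xa) g
                        = (beta (subalg_in Xa) : K) *: g) ->
  forall h, bullet H Sinv beta h g = (beta h : K) *: g.
Proof.
move=> SK SinvK gen_eigen; apply: gen_subalg_ind => // [|k a b ag bg|a b ag bg].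
- by rewrite bullet1 // rmorph1 scale1r.
- rewrite bullet_linearl // ag bg scalerA -scalerDl; congr (_ *: _).
  by rewrite linearD linearZ.
- rewrite bulletM // bg (scalable_linear (bullet_linearr _ _ _ _)) /= ag.
  by rewrite scalerA mulrC rmorphM.
Qed.

(** * The coproduct of b'^coop *)

Section Coproduct.
Variables (K : fieldType) (n : nat) (A : algType K) (x : qgen n.-1 -> A).
Variables (HA : hopf_structure A) (H : hopf_structure (b' x)).
Hypotheses (HA_quantum : is_quantum_hopf x HA) (H_coop : is_b'_coop HA H).

Lemma tmap_b'_val_inj : injective (tmap (b'_val (x := x)) (b'_val (x := x))).
Proof.
by apply: (@tmap_inj _ _ _ _ _ (@subalg_val _ _ _) (@subalg_val _ _ _));
  apply: val_inj.
Qed.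

Lemma tens_b'_val_bilin : bilin (fun a b : b' x => tens (b'_val a) (b'_val b)).
Proof.
exact: (@tmap_bilin _ _ _ _ _ (@subalg_val _ _ _) (@subalg_val _ _ _)
  (linearP _) (linearP _)).
Qed.

(** The coproduct of H is known only through its image in the tensor square of
A, where it is compared by injectivity. *)
Lemma comul_bw' i : comul H (bw' x i) = tens (bw' x i) (bw' x i).
Proof.
have [_ [Dw _] _ _] := HA_quantum i.
apply: tmap_b'_val_inj; rewrite H_coop.1 Dw tswap_tens /tmap tlift_tens //.
exact: tens_b'_val_bilin.
Qed.

Lemma counit_bw' i : counit H (bw' x i) = 1.
Proof. by have [_ [_ ew] _ _] := HA_quantum i; rewrite H_coop.2. Qed.

Lemma comul_bf i : comul H (bf x i) = tens (bf x i) 1 + tens (bw' x i) (bf x i).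
Proof.
have [_ _ _ [Df _]] := HA_quantum i.
have tB := tens_b'_val_bilin.
apply: tmap_b'_val_inj; rewrite H_coop.1 Df tswapD !tswap_tens /tmap tliftD //.
by rewrite !tlift_tens.
Qed.

Lemma counit_bf i : counit H (bf x i) = 0.
Proof. by have [_ _ _ [_ ef]] := HA_quantum i; rewrite H_coop.2. Qed.

Lemma comul_prod_bw' (d : 'I_n.-1 -> nat) :
  let g := \prod_i bw' x i ^+ d i in comul H g = tens g g /\ counit H g = 1.
Proof.
pose T (a : b' x) := comul H a = tens a a /\ counit H a = 1.
have TM a b : T a -> T b -> T (a * b).
  move=> [Da ea] [Db eb]; split; first by rewrite comulM Da Db tensM.
  by rewrite rmorphM /= ea eb mulr1.
have T1 : T 1 by split; [exact: comul1|exact: rmorph1].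
apply: (big_ind T) => // i _; elim: (d i) => [|k IH] //.
rewrite exprS; apply: TM IH; split; [exact: comul_bw'|exact: counit_bw'].
Qed.

End Coproduct.

(** * Modules supported on a line *)

(** The generators on which the action is prescribed; the inverses of the
toral ones are powers of them when w i ^+ l = w' i ^+ l = 1. *)
Definition efw_gen (K : fieldType) (m : nat) (A : algType K) (x : qgen m -> A)
    (a : A) : Prop :=
  exists i, [\/ a = x (gen_e i), a = x (gen_f i), a = x (gen_w i)
              | a = x (gen_w' i)].

Section OneDimensional.
Variables (K : fieldType) (n : nat) (A : algType K) (x : qgen n.-1 -> A).
Variables (H : hopf_structure (b' x)) (Sinv : b' x -> b' x).
Variables (pw : 'I_n.-1 -> {lrmorphism b' x -> K^o}).
Variables (pe : 'I_n.-1 -> {linear b' x -> K^o}) (chi : {lrmorphism A -> K^o}).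
Variable g : b' x.
Local Notation beta := (subalg_res (b'_gen x) chi).
Hypothesis g_neq0 : g != 0.
Hypothesis bullet_g : forall h, bullet H Sinv beta h g = (beta h : K) *: g.
Hypothesis coact_w : forall i, coact H (pw i) g = (chi (x (gen_w i)) : K) *: g.
Hypothesis coact_e : forall i, coact H (pe i) g = (chi (x (gen_e i)) : K) *: g.

(** The embedding that realises K_chi as the line K g. *)
Definition char_emb (c : char_module chi) : b' x := (c : K) *: g.

Lemma char_emb_inj : injective char_emb.
Proof.
move=> c d /eqP; rewrite -subr_eq0 -scalerBl scaler_eq0 (negPf g_neq0) orbF.
by rewrite subr_eq0 => /eqP.
Qed.

Lemma bullet_char_module : is_bullet_module H Sinv pw pe beta g char_emb.
Proof.
split; first exact: char_emb_inj.
- move=> k m m'; rewrite /char_emb scalerA -scalerDl; congr (_ *: _).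
  congr (_ + _); rewrite [LHS]/(_ * _) /=.
  by rewrite linearZ /= rmorph1 [k *: _]mulr1.
- move=> b; split=> [[c <-]|[h <-]]; last by exists (beta h); rewrite bullet_g.
  exists ((c : K)%:A); rewrite bullet_g /char_emb; congr (_ *: _).
  by rewrite linearZ /= rmorph1 [LHS]mulr1.
- move=> h c; rewrite /char_emb (scalable_linear (bullet_linearr _ _ _ h)).
  by rewrite /= bullet_g scalerA mulrC.
- move=> i c; rewrite /char_emb (scalable_linear (coact_linear _ _)).
  by rewrite /= coact_w scalerA mulrC.
- move=> i c; rewrite /char_emb (scalable_linear (coact_linear _ _)).
  by rewrite /= coact_e scalerA mulrC.
Qed.

Hypothesis A_gen : forall a, subalg_gen (efw_gen x) a.

(** An element a acts on the vector over g by the scalar chi(a): this holds for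
generators and is stable under linear combinations and products. *)
Lemma bullet_module_char (M : lmodType A) (j : M -> b' x) :
  is_bullet_module H Sinv pw pe beta g j ->
  exists phi : {linear char_module chi -> M}, bijective phi.
Proof.
case=> j_inj j_lin j_im j_H j_w j_e.
have [m0 jm0] : exists m, j m = g.
  apply/j_im; exists 1; rewrite bullet_g rmorph1; exact: scale1r.
have jZ k m : j (k%:A *: m) = k *: j m.
  have j0 : j 0 = 0.
    by have := j_lin (-1) 0 0; rewrite scaler0 add0r scaleN1r addNr.
  by have := j_lin k m 0; rewrite j0 !addr0.
have act a : a *: m0 = (chi a : K)%:A *: m0.
  have chiD k u v : (chi (k *: u + v) : K) = k * chi u + chi v.
    by rewrite linearD linearZ.
  have chiM u v : (chi (u * v) : K) = chi u * chi v by exact: rmorphM.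
  elim: (A_gen a) => {a} [a [i aE]||k a b _ IHa _ IHb|a b _ IHa _ IHb].
  - apply: j_inj; rewrite jZ jm0; case: aE => ->.
    + by rewrite j_e jm0 coact_e.
    + by rewrite -[x _]/(b'_val (bf x i)) j_H jm0 bullet_g.
    + by rewrite j_w jm0 coact_w.
    + by rewrite -[x _]/(b'_val (bw' x i)) j_H jm0 bullet_g.
  - by rewrite rmorph1 !scale1r.
  - rewrite chiD scalerDl -[k *: a]mulr_algl -scalerA IHa IHb scalerA -scalerDl.
    by congr (_ *: _); rewrite mulr_algl scalerDl scalerA.
  - rewrite chiM -scalerA IHb scalerA -[a * _]/(a * (_ *: 1)) -scalerAr mulr1.
    rewrite -[_ *: a]mulr_algl -scalerA IHa scalerA; congr (_ *: _).
    by rewrite mulr_algl scalerA mulrC.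
pose phi (c : char_module chi) : M := (c : K)%:A *: m0.
have phi_lin : linear phi.
  move=> a c d; rewrite /phi scalerA -[a * _]/(a * (_ *: 1)) -scalerAr mulr1.
  rewrite -[_ *: a]mulr_algl -scalerA act scalerA -scalerDl; congr (_ *: _).
  rewrite mulr_algl scalerA -scalerDl; congr (_ *: _); congr (_ + _).
  by rewrite mulrC.
pose phiL := GRing.isLinear.Build _ _ _ _ phi phi_lin.
pose Phi : {linear char_module chi -> M} := HB.pack phi phiL.
exists Phi.
have j_scalar m : exists c : K, j m = c *: g.
  have [h hE] : exists h, bullet H Sinv beta h g = j m by apply/j_im; exists m.
  by exists (beta h); rewrite -hE bullet_g.
have [psi psiP] := choice j_scalar.
have jphi c : j (phi c) = (c : K) *: g by rewrite /phi jZ jm0.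
exists psi => [c|m]; last by apply: j_inj; rewrite jphi psiP.
by apply: char_emb_inj; rewrite /char_emb -psiP jphi.
Qed.

End OneDimensional.

(** * Invertibility of the matrix A and powers of theta *)

Lemma dot_eps_alpha n a b : (a < n)%N ->
  dot (eps n a) (alpha n b) = (a == b)%:R - (a == b.+1)%:R.
Proof.
move=> lt_an; rewrite /dot (bigD1 (Ordinal lt_an)) //= !mxE eqxx mul1r.
rewrite big1 ?addr0 // => k; rewrite -val_eqE /= !mxE => /negPf ->.
by rewrite mul0r.
Qed.

Section Determinant.
Variables y z : int.

Lemma Amx_minor m : row' ord0 (col' ord0 (Amx m.+1 y z)) = Amx m y z.
Proof. by apply/matrixP => i j; rewrite !mxE !lift0 /= !eqSS. Qed.

(** Expansion along the first column, then along the first row of the second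
minor. *)
Lemma det_Amx_rec m : \det (Amx m.+2 y z)
  = (y - z) * \det (Amx m.+1 y z) + y * z * \det (Amx m y z).
Proof.
rewrite (expand_det_col _ ord0) !big_ord_recl big1 ?addr0; last first.
  by move=> i _; rewrite !mxE /= mul0r.
rewrite /cofactor Amx_minor !mxE /= expr0 mul1r; congr (_ + _).
rewrite (expand_det_row _ ord0) big_ord_recl big1 ?addr0; last first.
  by move=> i _; rewrite !mxE /= mul0r.
rewrite /cofactor !mxE /= [X in \det X](_ : _ = Amx m y z); last first.
  by apply/matrixP => i j; rewrite !mxE !lift0 /= !eqSS.
by rewrite !expr1 expr0 mul1r; ring.
Qed.

Lemma det_Amx m : \det (Amx m y z)
  = \sum_(k < m.+1) (-1) ^+ k * y ^+ (m - k) * z ^+ k.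
Proof.
(* T satisfies the first order recurrence TS, which implies the second order
   one satisfied by the determinant. *)
pose T p : int := \sum_(k < p.+1) (-1) ^+ k * y ^+ (p - k) * z ^+ k.
have T0 : T 0%N = 1 by rewrite /T big_ord1 !expr0 !mulr1.
have TS p : T p.+1 = y * T p + (- z) ^+ p.+1.
  rewrite /T big_ord_recr /= subnn expr0 mulr1 -exprMn mulN1r; congr (_ + _).
  rewrite mulr_sumr; apply: eq_bigr => k _.
  by rewrite subSn -1?ltnS // exprS; ring.
rewrite -/(T m); elim/ltn_ind: m => -[|[|m]] IH.
- by rewrite det_mx00 T0.
- by rewrite det_mx11 mxE /= TS T0 expr1 mulr1.
- by rewrite det_Amx_rec !IH // !TS !exprS; ring.
Qed.

End Determinant.

Lemma coprimez_unit_Zp l (a : int) :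
  coprimez a l.+2%:Z -> (a%:~R : 'Z_l.+2) \is a GRing.unit.
Proof.
case/coprimezP => -[u v] /= uv1; apply/unitrPr; exists (u%:~R).
have := congr1 (fun b : int => b%:~R : 'Z_l.+2) uv1.
by rewrite rmorphD !rmorphM /= -[l.+2%:~R]pmulrn pchar_Zp // mulr0 addr0 mulrC.
Qed.

Lemma Amx_unit l m (y z : int) :
  coprimez (\sum_(k < m.+1) (-1) ^+ k * y ^+ (m - k) * z ^+ k) l.+2%:Z ->
  (map_mx intr (Amx m y z) : 'M['Z_l.+2]_m) \in unitmx.
Proof. by rewrite -det_Amx unitmxE det_map_mx => /coprimez_unit_Zp. Qed.

(** Powers of theta depend only on the exponent modulo its order, so the linear
system over Z/l that defines d becomes an identity between products of powers
of theta. *)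
Section Powers.
Variables (K : fieldType) (l : nat) (theta : K).
Hypothesis theta_prim : l.+2.-primitive_root theta.

Lemma prim_exprZpD (a b : 'Z_l.+2) :
  theta ^+ (a + b)%R = theta ^+ a * theta ^+ b.
Proof. by rewrite (prim_expr_mod theta_prim) exprD. Qed.

Lemma prim_exprZpM (a b : 'Z_l.+2) : theta ^+ (a * b)%R = (theta ^+ a) ^+ b.
Proof. by rewrite (prim_expr_mod theta_prim) exprM. Qed.

Lemma prim_exprZp_nat k : theta ^+ (k%:R : 'Z_l.+2) = theta ^+ k.
Proof. by rewrite val_Zp_nat // (prim_expr_mod theta_prim). Qed.

Lemma prim_exprz (a : int) : theta ^ a = theta ^+ (a%:~R : 'Z_l.+2).
Proof.
case: a => k; first by rewrite prim_exprZp_nat.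
have := prim_exprZpD (- k.+1%:R) k.+1%:R.
rewrite addNr expr0 prim_exprZp_nat NegzE rmorphN /= => theta1.
have thetaX0 : theta ^+ k.+1 != 0.
  by apply: contra_eqT theta1 => /negPn/eqP ->; rewrite mulr0 oner_neq0.
by rewrite -[LHS]mul1r theta1 -mulrA mulfV // mulr1.
Qed.

Lemma prim_prod_invmx m (A : 'M[int]_m) (c : 'I_m -> nat) :
  let Al : 'M['Z_l.+2]_m := map_mx intr A in
  let d := invmx Al *m \col_i (c i)%:R in
  Al \in unitmx ->
  forall i, \prod_j (theta ^ A i j) ^+ d j ord0 = theta ^+ c i.
Proof.
move=> Al d Au i; have /matrixP/(_ i ord0) : Al *m d = \col_i (c i)%:R.
  by rewrite mulKVmx.
rewrite !mxE => Ad; rewrite -prim_exprZp_nat -Ad.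
rewrite (big_morph (fun a : 'Z_l.+2 => theta ^+ a) (id1 := 1) (op1 := *%R)) //.
  by apply: eq_bigr => j _; rewrite [Al i j]mxE prim_exprZpM -prim_exprz.
exact: prim_exprZpD.
Qed.

End Powers.

(** Entry (i, j) of A is the exponent of theta in <w_i, w'_j>. *)
Lemma dot_Amxl n (y z : int) (i j : 'I_n.-1) :
  y * dot (eps n i) (alpha n j) + z * dot (eps n i.+1) (alpha n j)
  = Amx n.-1 y z i j.
Proof.
have [ltin ltiSn] : (i < n /\ i.+1 < n)%N by have := ltn_ord i; lia.
rewrite !dot_eps_alpha // !mxE.
by do 7?[case: eqP => ? /=]; first [ring | exfalso; lia].
Qed.

(** Entry (i, j) of A is also the exponent of theta when w'_j moves past f_i:
this exponent agrees with the previous one because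
<eps_i, alpha_j> = - <eps_(j+1), alpha_i>. *)
Lemma dot_Amxr n (y z : int) (i j : 'I_n.-1) :
  y * - dot (eps n j.+1) (alpha n i) + z * - dot (eps n j) (alpha n i)
  = Amx n.-1 y z i j.
Proof.
have [ltjn ltjSn] : (j < n /\ j.+1 < n)%N by have := ltn_ord j; lia.
rewrite !dot_eps_alpha // !mxE.
by do 7?[case: eqP => ? /=]; first [ring | exfalso; lia].
Qed.

Lemma exprz_rs (K : fieldType) (theta : K) (y z : nat) (a b : int) :
  theta != 0 ->
  (theta ^+ y) ^ a * (theta ^+ z) ^ b = theta ^ (y%:Z * a + z%:Z * b).
Proof. by move=> t0; rewrite !exprnP !exprz_exp expfzDr. Qed.

(** * The restricted quantum group: relations and generators *)

(** The relations are read off in an arbitrary algebra that receives a morphism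
killing them, which keeps the iterated quotient abstract. *)
Section Relations.
Variables (K : fieldType) (n : nat) (r s : K) (A B : algType K).
Variables (var : qgen n.-1 -> A) (psi : {lrmorphism A -> B}).
Local Notation e i := (psi (var (gen_e i))).
Local Notation f i := (psi (var (gen_f i))).
Local Notation w i := (psi (var (gen_w i))).
Local Notation w' i := (psi (var (gen_w' i))).
Local Notation wV i := (psi (var (gen_wV i))).
Local Notation w'V i := (psi (var (gen_w'V i))).
Local Notation ip i j := (dot (eps n i) (alpha n j)).
Implicit Types i j : 'I_n.-1.

Section Defining.
Hypothesis psi0 : forall p, U_rel r s var p -> psi p = 0.

Lemma rel_w'C i j : w' i * w' j = w' j * w' i.
Proof.
have := psi0 (@R1_comm K n r s A var (gen_w' i) (gen_w' j) isT isT).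
by rewrite rmorphB !rmorphM => /subr0_eq.
Qed.

Lemma rel_wV i : w i * wV i = 1.
Proof.
by have := psi0 (R1_w r s var i); rewrite rmorphB rmorphM rmorph1 => /subr0_eq.
Qed.

Lemma rel_w'V i : w' i * w'V i = 1.
Proof.
by have := psi0 (R1_w' r s var i); rewrite rmorphB rmorphM rmorph1 => /subr0_eq.
Qed.

Lemma rel_we i j : w i * e j = (r ^ ip i j * s ^ ip i.+1 j) *: (e j * w i).
Proof.
have := psi0 (R2_e r s var i j).
by rewrite rmorphB /= linearZ /= !rmorphM => /subr0_eq.
Qed.

Lemma rel_wf i j :
  w i * f j = (r ^ (- ip i j) * s ^ (- ip i.+1 j)) *: (f j * w i).
Proof.
have := psi0 (R2_f r s var i j).
by rewrite rmorphB /= linearZ /= !rmorphM => /subr0_eq.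
Qed.

Lemma rel_w'f i j :
  w' i * f j = (r ^ (- ip i.+1 j) * s ^ (- ip i j)) *: (f j * w' i).
Proof.
have := psi0 (R3_f r s var i j).
by rewrite rmorphB /= linearZ /= !rmorphM => /subr0_eq.
Qed.

Lemma rel_ef i : e i * f i - f i * e i = (r - s)^-1 *: (w i - w' i).
Proof.
have := psi0 (R4 r s var i i).
by rewrite eqxx mul1r !rmorphB /= linearZ /= rmorphB !rmorphM => /subr0_eq.
Qed.

End Defining.

Lemma rel_wX l i :
  (forall p, u_rel r s var l p -> psi p = 0) -> w i ^+ l = 1.
Proof.
move=> /(_ _ (rel_w r s var l i)).
by rewrite rmorphB rmorphXn rmorph1 => /subr0_eq.
Qed.

Lemma rel_w'X l i :
  (forall p, u_rel r s var l p -> psi p = 0) -> w' i ^+ l = 1.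
Proof.
move=> /(_ _ (rel_w' r s var l i)).
by rewrite rmorphB rmorphXn rmorph1 => /subr0_eq.
Qed.

End Relations.

Lemma quot_pi0 (K : fieldType) (A : algType K) (P : A -> Prop)
  (ag : augmentation P) p : P p -> quot_pi ag p = 0.
Proof.
move=> Pp; rewrite -(rmorph0 (quot_pi ag)); apply/quot_piP; rewrite subr0.
rewrite -[p]mulr1 -[p * 1]addr0 -[p]mul1r.
by apply: ideal_genD => //; apply: ideal_gen0.
Qed.

Lemma free_alg_gen (K : fieldType) (I : choiceType) (a : free_alg K I) :
  subalg_gen (fun b => exists i, b = free_var K i) a.
Proof.
have genZ (c : K) (b : free_alg K I) X :
    @subalg_gen K (free_alg K I) X b -> subalg_gen X (c *: b).
  move=> Xb; rewrite -[_ *: _]addr0; apply: subalg_genD => //.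
  by rewrite -(addNr 1) -scaleN1r; apply: subalg_genD; apply: subalg_gen1.
rewrite [a]monalgE; apply: big_ind => [|b c bG cG|k _].
- rewrite -[0](scale0r (1 : free_alg K I)); apply: genZ; exact: subalg_gen1.
- by rewrite -[b]scale1r; apply: subalg_genD.
rewrite (_ : << _ *g k >> = a@_k *: (<< 1 *g k >> : free_alg K I)); last first.
  by apply/malgP => k'; rewrite mcoeffZ !mcoeffU mulrnAr mulr1.
apply: genZ; case: k => w; elim: w => [|i w IHw].
  rewrite (_ : FMonom _ = mone); first exact: subalg_gen1.
  by apply: val_inj; rewrite /= fm1.
rewrite (_ : << _ *g _ >> =
  free_var K i * (<< 1 *g FMonom w >> : free_alg K I)).
  by apply: subalg_genM IHw; apply: subalg_gen_in; exists i.
rewrite malgM_def fgmulUU mulr1; congr (<< _ *g _ >>).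
by apply: val_inj; rewrite /= fmM fmU.
Qed.

Lemma subalg_gen_map (K : fieldType) (A B : algType K)
    (psi : {lrmorphism A -> B}) (X : A -> Prop) (Y : B -> Prop) :
  (forall a, X a -> subalg_gen Y (psi a)) ->
  forall a, subalg_gen X a -> subalg_gen Y (psi a).
Proof.
move=> XY a; elim=> {a} [a Xa||k a b _ IHa _ IHb|a b _ IHa _ IHb].
- exact: XY.
- by rewrite rmorph1; apply: subalg_gen1.
- by rewrite linearP; apply: subalg_genD.
- by rewrite rmorphM; apply: subalg_genM.
Qed.

Section RestrictedQuantumGroup.
Variables (K : fieldType) (n : nat) (r s : K) (l : nat) (l_gt0 : (0 < l)%N).

Definition u_pi : {lrmorphism F_free K n -> u_rs n r s l_gt0} :=
  [the {lrmorphism _ -> _} of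
     quot_pi (uaug n r s l_gt0) \o quot_pi (Uaug n r s)].

Lemma u_pi0 p : U_rel r s (@F_gen K n) p -> u_pi p = 0.
Proof. by move=> Pp; rewrite /= (quot_pi0 (Uaug n r s) Pp) rmorph0. Qed.

End RestrictedQuantumGroup.

Lemma subalg_gen_inv (K : fieldType) (A : algType K) (X : A -> Prop) l a b :
  (0 < l)%N -> subalg_gen X a -> a * b = 1 -> a ^+ l = 1 -> subalg_gen X b.
Proof.
move=> l_gt0 Xa ab al; have -> : b = a ^+ l.-1.
  by rewrite -[b]mul1r -al -(prednK l_gt0) exprSr -mulrA ab mulr1.
elim: l.-1 => [|k IH]; first exact: subalg_gen1.
by rewrite exprS; apply: subalg_genM.
Qed.

Lemma u_rs_gen (K : fieldType) (n : nat) (r s : K) (l : nat) (l_gt0 : (0 < l)%N)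
    (x := u_gen r s l_gt0) (a : u_rs n r s l_gt0) :
  subalg_gen (efw_gen x) a.
Proof.
pose psi := u_pi n r s l_gt0.
have -> : a = psi (quot_repr (quot_repr a)) by rewrite /psi /= !quot_reprK.
apply: subalg_gen_map (free_alg_gen _) => _ [g ->].
have rel_pi p :
    u_rel r s (@U_gen K n r s) l p -> quot_pi (uaug n r s l_gt0) p = 0.
  by move=> Pp; apply: quot_pi0.
have gen_w_in i : subalg_gen (efw_gen x) (x (gen_w i)).
  by apply: subalg_gen_in; exists i; constructor 3.
have gen_w'_in i : subalg_gen (efw_gen x) (x (gen_w' i)).
  by apply: subalg_gen_in; exists i; constructor 4.
case: g => i.
- by apply: subalg_gen_in; exists i; constructor 1.
- by apply: subalg_gen_in; exists i; constructor 2.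
- exact: gen_w_in.
- apply: (subalg_gen_inv l_gt0) (gen_w_in i) _ _.
    exact: (rel_wV (@u_pi0 K n r s l l_gt0)).
  exact: (rel_wX i rel_pi).
- exact: gen_w'_in.
- apply: (subalg_gen_inv l_gt0) (gen_w'_in i) _ _.
    exact: (rel_w'V (@u_pi0 K n r s l l_gt0)).
  exact: (rel_w'X i rel_pi).
Qed.

(** * Values of a character on the generators *)

Section Characters.
Variables (K : fieldType) (n l : nat) (r s theta : K) (A : algType K).
Variables (x : qgen n.-1 -> A) (chi : {lrmorphism A -> K^o}).
Local Notation e i := (x (gen_e i)).
Local Notation f i := (x (gen_f i)).
Local Notation w i := (x (gen_w i)).
Local Notation w' i := (x (gen_w' i)).
Local Notation ip i j := (dot (eps n i) (alpha n j)).
Implicit Types i j : 'I_n.-1.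
Hypotheses (theta_prim : l.-primitive_root theta) (r_neq_s : r != s).
Hypothesis we : forall i j,
  w i * e j = (r ^ ip i j * s ^ ip i.+1 j) *: (e j * w i).
Hypothesis wf : forall i j,
  w i * f j = (r ^ (- ip i j) * s ^ (- ip i.+1 j)) *: (f j * w i).
Hypothesis ef : forall i, e i * f i - f i * e i = (r - s)^-1 *: (w i - w' i).
Hypothesis wX : forall i, w i ^+ l = 1.

Lemma chi_wX i : (chi (w i) : K) ^+ l = 1.
Proof. by have := congr1 chi (wX i); rewrite rmorphXn rmorph1. Qed.

Lemma chi_w_neq0 i : (chi (w i) : K) != 0.
Proof.
apply/eqP => w0; have := chi_wX i; rewrite w0 expr0n.
rewrite (gtn_eqF (prim_order_gt0 theta_prim)) => /eqP.
by rewrite eq_sym oner_eq0.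
Qed.

Lemma ip_diag i : ip i i = 1 /\ ip i.+1 i = -1.
Proof.
have [lt_in lt_iSn] : (i < n /\ i.+1 < n)%N by have := ltn_ord i; lia.
by rewrite !dot_eps_alpha //; split; lia.
Qed.

(** A character takes values in a commutative ring, where the invertible chi(w i)
can be cancelled. *)
Lemma char_zero (a : A) (q : K) i :
  w i * a = q *: (a * w i) -> q != 1 -> chi a = 0.
Proof.
move=> wa q1; have := congr1 (fun b => chi b : K) wa.
rewrite linearZ /= !rmorphM => /eqP; rewrite -subr_eq0.
rewrite [X in X == 0](_ : _ = (1 - q) * (chi a : K) * (chi (w i) : K));
  last first.
  rewrite /GRing.scale /=; ring.
rewrite !mulf_eq0 (negPf (chi_w_neq0 i)) subr_eq0 eq_sym (negPf q1) orbF /=.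
by move/eqP.
Qed.

Lemma char_e i : chi (e i) = 0.
Proof.
apply: char_zero (we i i) _; have [-> ->] := ip_diag i.
by rewrite expr1z -invr_expz expr1z; apply: contra r_neq_s => /eqP/divr1_eq ->.
Qed.

Lemma char_f i : chi (f i) = 0.
Proof.
apply: char_zero (wf i i) _; have [-> ->] := ip_diag i.
rewrite opprK expr1z -invr_expz expr1z mulrC.
by apply: contra r_neq_s => /eqP/divr1_eq ->.
Qed.

Lemma char_w' i : chi (w' i) = chi (w i).
Proof.
have := congr1 chi (ef i); rewrite linearZ /= !rmorphB !rmorphM.
rewrite /= char_e char_f mul0r subrr => /esym/eqP.
by rewrite scaler_eq0 invr_eq0 !subr_eq0 (negPf r_neq_s) /= eq_sym => /eqP.
Qed.

Lemma char_value i : exists c : nat,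
  [/\ (c < l)%N, chi (w i) = theta ^+ c & chi (w' i) = theta ^+ c].
Proof.
have [c wc] := prim_rootP theta_prim (chi_wX i).
by exists c; rewrite char_w'; split.
Qed.

End Characters.

(** * The line spanned by the group-like element g *)

Lemma prod_skew_comm (K : fieldType) (A : algType K) m (u : 'I_m -> A) (f : A)
    (q : 'I_m -> K) (d : 'I_m -> nat) :
  (forall j, u j * f = q j *: (f * u j)) ->
  (\prod_j u j ^+ d j) * f = (\prod_j q j ^+ d j) *: (f * \prod_j u j ^+ d j).
Proof.
move=> uf; pose T (a : A) (b : K) := a * f = b *: (f * a).
have TM a b a' b' : T a b -> T a' b' -> T (a * a') (b * b').
  rewrite /T => ab a'b'; rewrite -mulrA a'b' -scalerAr (mulrA a f) ab.
  by rewrite -scalerAl scalerA mulrA (mulrC b').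
have T1 : T 1 1 by rewrite /T mul1r mulr1 scale1r.
apply: (big_ind2 T) => // j _.
elim: (d j) => [|k IH]; first by [].
by rewrite !exprS; apply: TM.
Qed.

Section GroupLike.
Variables (K : fieldType) (n : nat) (r s : K) (A : algType K).
Variables (x : qgen n.-1 -> A) (chi : {lrmorphism A -> K^o}).
Local Notation f i := (x (gen_f i)).
Local Notation w' i := (x (gen_w' i)).
Local Notation ip i j := (dot (eps n i) (alpha n j)).
Implicit Types i j : 'I_n.-1.
Variables (HA : hopf_structure A) (H : hopf_structure (b' x)).
Hypotheses (HA_quantum : is_quantum_hopf x HA) (H_coop : is_b'_coop HA H).
Variable Sinv : b' x -> b' x.
Hypotheses (SK : cancel (antipode H) Sinv) (SinvK : cancel Sinv (antipode H)).
Variables (pw : 'I_n.-1 -> {lrmorphism b' x -> K^o}).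
Variables (pe : 'I_n.-1 -> {linear b' x -> K^o}).
Hypothesis H_pairing : is_pairing r s H pw pe.
Variable d : 'I_n.-1 -> nat.
Local Notation g := (\prod_i bw' x i ^+ d i).
Local Notation beta := (subalg_res (b'_gen x) chi).
Hypothesis w'C : forall i j, w' i * w' j = w' j * w' i.
Hypothesis w'f : forall i j,
  w' i * f j = (r ^ (- ip i.+1 j) * s ^ (- ip i j)) *: (f j * w' i).
Hypothesis chi_f : forall i, chi (f i) = 0.

Lemma bw'_comm_prod i : bw' x i * g = g * bw' x i.
Proof.
apply: (big_ind (GRing.comm (bw' x i))) => [|a b|j _].
- exact: commr1.
- exact: commrM.
- by apply: commrX; apply: val_inj; apply: w'C.
Qed.

Lemma prod_bw'_bf i :
  g * bf x i = (\prod_(j < n.-1) (r ^ (- ip j.+1 i) * s ^ (- ip j i)) ^+ d j)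
               *: (bf x i * g).
Proof. by apply: prod_skew_comm => j; apply: val_inj; apply: w'f. Qed.

(** For h = f_i the two terms f_i g and g f_i of the bullet cancel because
the scalar exchanging g and f_i is chi(w'_i). *)
Lemma bullet_prod h :
  (forall i, chi (w' i)
     = \prod_(j < n.-1) (r ^ (- ip j.+1 i) * s ^ (- ip j i)) ^+ d j) ->
  bullet H Sinv beta h g = (beta h : K) *: g.
Proof.
move=> chi_w'; apply: (bullet_eigen SK SinvK) h => a Xa.
have [i [aE|aE]] := Xa.
  have -> : subalg_in Xa = bw' x i by apply: val_inj.
  rewrite bullet_grouplike //; last exact: comul_bw' HA_quantum H_coop i.
  rewrite bw'_comm_prod -mulrA (mul_Sinv_grouplike SK) ?mulr1 //.
    exact: comul_bw' HA_quantum H_coop i.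
  exact: counit_bw' HA_quantum H_coop i.
have -> : subalg_in Xa = bf x i by apply: val_inj.
have beta_f : beta (bf x i) = 0 by exact: chi_f.
rewrite (bullet_skew SK SinvK _ (comul_bw' HA_quantum H_coop i)
  (comul_bf HA_quantum H_coop i) (counit_bf HA_quantum H_coop i) beta_f).
by rewrite beta_f prod_bw'_bf -chi_w' subrr mul0r scale0r.
Qed.

Lemma coact_w_prod i : coact H (pw i) g
  = (\prod_(j < n.-1) (r ^ ip i j * s ^ ip i.+1 j) ^+ d j) *: g.
Proof.
rewrite coact_grouplike; last by case: (comul_prod_bw' HA_quantum H_coop d).
have [pwE _ _ _ _] := H_pairing.
congr (_ *: _); rewrite rmorph_prod; apply: eq_bigr => j _.
by rewrite rmorphXn /= pwE.
Qed.

Lemma coact_e_prod i : coact H (pe i) g = 0.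
Proof.
rewrite coact_grouplike; last by case: (comul_prod_bw' HA_quantum H_coop d).
have [_ _ peM pew' _] := H_pairing.
have TM a b : pe i a = 0 -> pe i b = 0 -> pe i (a * b) = 0.
  by move=> a0 b0; rewrite peM a0 b0 mul0r mulr0 addr0.
have T1 : pe i 1 = 0.
  have := peM i 1 1; rewrite mulr1 !rmorph1 mulr1 mul1r => /eqP.
  by rewrite -{1}[pe i 1]addr0 (inj_eq (addrI _)) eq_sym => /eqP.
rewrite (_ : pe i g = 0) ?scale0r //.
apply: (big_ind (fun a => pe i a = 0)) => // j _.
by elim: (d j) => [|k IH] //; rewrite exprS; apply: TM.
Qed.

(** Group-like elements have counit 1. *)
Lemma prod_bw'_neq0 : g != 0.
Proof.
have [_ eg] := comul_prod_bw' HA_quantum H_coop d.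
by apply: contra_eqN eg => /eqP ->; rewrite rmorph0 eq_sym oner_neq0.
Qed.

End GroupLike.

(** * Characters as modules H . g *)

Theorem proposition2p10 (K : closedFieldType) (charK : [pchar K] =i pred0)
    (n : nat) (n_ge2 : (2 <= n)%N)
    (r s theta : K) (ord_r ord_s l y z : nat)
    (r_order : ord_r.-primitive_root r) (s_order : ord_s.-primitive_root s)
    (r_neq_s : r != s)
    (lE : l = lcmn ord_r ord_s) (theta_prim : l.-primitive_root theta)
    (rE : r = theta ^+ y) (sE : s = theta ^+ z)
    (coprime_sum :
      coprimez (\sum_(k < n) (-1) ^+ k * y%:Z ^+ (n.-1 - k) * z%:Z ^+ k) l%:Z)
    (coprime_yz : coprimez (y%:Z - z%:Z) l%:Z) :
  let A : algType K := u_rs n r s (prim_order_gt0 theta_prim) in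
  let x : qgen n.-1 -> A := u_gen r s (prim_order_gt0 theta_prim) in
  forall (HA : hopf_structure A) (HA_quantum : is_quantum_hopf x HA)
    (H : hopf_structure (b' x)) (H_coop : is_b'_coop HA H)
    (Sinv : b' x -> b' x)
    (SK : cancel (antipode H) Sinv) (SinvK : cancel Sinv (antipode H))
    (pw : 'I_n.-1 -> {lrmorphism b' x -> K^o})
    (pe : 'I_n.-1 -> {linear b' x -> K^o})
    (H_pairing : is_pairing r s H pw pe)
    (chi : {lrmorphism A -> K^o}),
  (forall i : 'I_n.-1,
     [/\ chi (x (gen_e i)) = 0, chi (x (gen_f i)) = 0
       & exists c : nat, [/\ (c < l)%N, chi (x (gen_w i)) = theta ^+ c
                           & chi (x (gen_w' i)) = theta ^+ c]])
  /\
  (forall c : 'I_n.-1 -> nat,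
     (forall i, (c i < l)%N /\ chi (x (gen_w i)) = theta ^+ c i) ->
   let Al : 'M['Z_l]_n.-1 := map_mx intr (Amx n.-1 y z) in
   let d : 'cV['Z_l]_n.-1 := invmx Al *m \col_i (c i)%:R in
   let g : b' x := \prod_(i < n.-1) bw' x i ^+ d i 0 in
   let is_Hg := is_bullet_module H Sinv pw pe (subalg_res (b'_gen x) chi) g in
   [/\ Al \in unitmx,
       exists (M : lmodType A) (j : M -> b' x), is_Hg M j
     & forall (M : lmodType A) (j : M -> b' x), is_Hg M j ->
         exists phi : {linear char_module chi -> M}, bijective phi]).
Proof.
have l_gt0 := prim_order_gt0 theta_prim.
case: n n_ge2 coprime_sum => [//|m] n_ge2 coprime_sum.
(* 'Z_l is the ring of integers mod l only for l > 1, and l = 1 would give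
   r = s = 1. *)
case: l lE theta_prim coprime_sum coprime_yz l_gt0 => [//|[|l]] lE theta_prim.
  move=> _ _ _; have := prim_expr_order theta_prim; rewrite expr1 => theta1.
  by rewrite rE sE theta1 !expr1n eqxx in r_neq_s.
move=> coprime_sum coprime_yz _ A x HA HA_quantum H H_coop Sinv SK SinvK pw pe.
move=> H_pairing chi.
pose psi0 := @u_pi0 K m.+1 r s _ (prim_order_gt0 theta_prim).
have theta_neq0 : theta != 0 by rewrite (prim_root_eq0 theta_prim).
have wX i : x (gen_w i) ^+ l.+2 = 1.
  apply: (rel_wX (r := r) (s := s) (var := @U_gen K m.+1 r s)
    (psi := quot_pi (uaug m.+1 r s (prim_order_gt0 theta_prim))) i) => p.
  exact: quot_pi0.
have we := rel_we psi0.
have wf := rel_wf psi0.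
have w'f := rel_w'f psi0.
have w'C := rel_w'C psi0.
have ef := rel_ef psi0.
have chi_f i : chi (x (gen_f i)) = 0.
  exact: (char_f chi theta_prim r_neq_s wf wX).
have chi_e i : chi (x (gen_e i)) = 0.
  exact: (char_e chi theta_prim r_neq_s we wX).
have chi_w' i : chi (x (gen_w' i)) = chi (x (gen_w i)).
  exact: (char_w' chi theta_prim r_neq_s we wf ef wX).
split=> [i|c chi_w].
  split=> //; exact: (char_value chi theta_prim r_neq_s we wf ef wX).
move=> Al d g is_Hg.
have Al_unit : Al \in unitmx by apply: Amx_unit.
have prodE i := prim_prod_invmx theta_prim c Al_unit i.
have chi_w_l i : chi (x (gen_w i)) = \prod_(j < m)
    (r ^ dot (eps m.+1 i) (alpha m.+1 j)
     * s ^ dot (eps m.+1 i.+1) (alpha m.+1 j)) ^+ d j 0.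
  have [_ ->] := chi_w i; rewrite -prodE; apply: eq_bigr => j _.
  by rewrite rE sE exprz_rs // dot_Amxl.
have chi_w'_r i : chi (x (gen_w' i)) = \prod_(j < m)
    (r ^ (- dot (eps m.+1 j.+1) (alpha m.+1 i))
     * s ^ (- dot (eps m.+1 j) (alpha m.+1 i))) ^+ d j 0.
  rewrite chi_w'; have [_ ->] := chi_w i; rewrite -prodE; apply: eq_bigr => j _.
  by rewrite rE sE exprz_rs // dot_Amxr.
have g_neq0 : g != 0 := prod_bw'_neq0 HA_quantum H_coop _.
have bullet_g h : bullet H Sinv (subalg_res (b'_gen x) chi) h g
    = (subalg_res (b'_gen x) chi h : K) *: g.
  exact: (bullet_prod HA_quantum H_coop SK SinvK w'C w'f chi_f).
have coact_w i : coact H (pw i) g = (chi (x (gen_w i)) : K) *: g.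
  by rewrite chi_w_l; exact: (coact_w_prod HA_quantum H_coop H_pairing).
have coact_e i : coact H (pe i) g = (chi (x (gen_e i)) : K) *: g.
  by rewrite chi_e scale0r; exact: (coact_e_prod HA_quantum H_coop H_pairing).
split=> //.
  exists (char_module chi), (@char_emb _ _ _ x chi g).
  exact: (bullet_char_module g_neq0 bullet_g coact_w coact_e).
move=> M j; apply: (bullet_module_char g_neq0 bullet_g coact_w coact_e).
exact: u_rs_gen.
Qed.
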